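(* Let $n\ge 2$ and let $k$ be an integer with $0<k<n$. Let $K$ and $L$ be star bodies in $\mathbb{R}^n$, and let $f$ and $g$ be non-negative continuous functions on $K$ and $L$, respectively, such that $\|g\|_\infty=g(0)=1$. Then $$\frac{\int_K f}{\left(\int_L g\right)^{\frac{n-k}{n}}|K|^{\frac kn}}\le \frac{n}{n-k}\,\left(d_{\rm ovr}(K,\mathcal{BP}_k^n)\right)^k\max_{H\in Gr_{n-k}}\frac{\int_{K\cap H}f}{\int_{L\cap H}g}.$$
   Context: $|\cdot|$ denotes volume (Lebesgue measure) of the appropriate dimension; integrals over $K\cap H$, $L\cap H$ are with respect to $(n-k)$-dimensional Lebesgue measure on $H$. $Gr_{n-k}$ is the Grassmannian of $(n-k)$-dimensional linear subspaces of $\mathbb{R}^n$. $\|g\|_\infty$ is the supremum of $g$ on $L$. A closed bounded set $K\subset\mathbb{R}^n$ is a star body if every straight line through the origin crosses the boundary of $K$ at exactly two points different from the origin, the origin is an interior point of $K$, and the Minkowski functional $\|x\|_K=\min\{a\ge 0: x\in aK\}$ is a continuous function on $\mathbb{R}^n$. Star bodies are not assumed origin-symmetric unless stated. For $1\le k\le n-1$, the spherical Radon transform $\mathcal{R}_{n-k}:C(S^{n-1})\to C(Gr_{n-k})$ is $\mathcal{R}_{n-k}h(H)=\int_{S^{n-1}\cap H}h(x)\,dx$, with respect to the (non-normalized) surface measure on the sphere $S^{n-1}\cap H$ (counting measure when $n-k=1$). An origin-symmetric star body $D$ in $\mathbb{R}^n$ is a generalized $k$-intersection body, written $D\in\mathcal{BP}_k^n$,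 if there is a finite non-negative Borel measure $\nu_D$ on $Gr_{n-k}$ such that for every $h\in C(S^{n-1})$, $$\int_{S^{n-1}}\|x\|_D^{-k}h(x)\,dx=\int_{Gr_{n-k}}\mathcal{R}_{n-k}h(H)\,d\nu_D(H).$$ The outer volume ratio distance from $K$ to a class $\Omega$ of bodies in $\mathbb{R}^n$ is $$d_{\rm ovr}(K,\Omega)=\inf\left\{\left(\frac{|D|}{|K|}\right)^{1/n}: K\subset D,\ D\in\Omega\right\}.$$ *)

(* Defs.v *)
From HB Require Import structures.
From mathcomp Require Import all_boot all_order all_algebra.
From mathcomp Require Import all_classical all_reals all_analysis.
From mathcomp Require Import measurable_realfun.

Set Implicit Arguments.
Unset Strict Implicit.
Unset Printing Implicit Defensive.

Import Order.TTheory GRing.Theory Num.Theory.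
Import numFieldNormedType.Exports.

Local Open Scope classical_set_scope.
Local Open Scope ring_scope.

(* R^n is 'rV[R]_n, with the topology of the library (sup norm) and the
   product sigma-algebra, generated by the coordinates as is done by the
   library for tuples; since R is second countable, this is also the Borel
   sigma-algebra. *)
Definition measure_rV_display : measure_display -> measure_display.
Proof. exact. Qed.

Section measurable_rV.
Context {R : realType} (n : nat).

Definition rV_coord (i : 'I_n) (x : 'rV[R]_n) : R := x ord0 i.

Let rV_set0 : g_sigma_preimage rV_coord set0.
Proof. exact: sigma_algebra0. Qed.

Let rV_setC A : g_sigma_preimage rV_coord A -> g_sigma_preimage rV_coord (~` A).
Proof. exact: sigma_algebraC. Qed.

Let rV_bigcup (F : (set 'rV[R]_n)^nat) :
  (forall i, g_sigma_preimage rV_coord (F i)) ->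
  g_sigma_preimage rV_coord (\bigcup_i (F i)).
Proof. exact: sigma_algebra_bigcup. Qed.

HB.instance Definition _ := @isMeasurable.Build
  (measure_rV_display default_measure_display) 'rV[R]_n
  (g_sigma_preimage rV_coord) rV_set0 rV_setC rV_bigcup.

Lemma measurable_rV_coord (i : 'I_n) : measurable_fun setT (rV_coord i).
Proof.
move=> _ Y mY; rewrite setTI; apply: sub_sigma_algebra => /=.
rewrite -bigcup_seq/=; exists i => /=; first by rewrite mem_index_enum.
by exists Y => //; rewrite setTI.
Qed.

Lemma measurable_fun_rV d (T : measurableType d) (f : T -> 'rV[R]_n) :
  (forall i, measurable_fun setT (fun x => f x ord0 i)) ->
  measurable_fun setT f.
Proof.
move=> mf _ A; rewrite setTI.
suff : g_sigma_preimage rV_coord `<=` [set A | measurable (f @^-1` A)] by exact.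
apply: smallest_sub.
  split => /=.
  - by rewrite preimage_set0.
  - by move=> B mB; rewrite setTD preimage_setC; exact: measurableC.
  - by move=> F mF; rewrite preimage_bigcup; exact: bigcup_measurable.
rewrite -bigcup_seq => B [i _ [Y mY <-]] /=.
by have := mf i measurableT _ mY; rewrite !setTI.
Qed.

End measurable_rV.

Section pack_sigma_finite.
Context {R : realType} d (T : measurableType d) (mu : set T -> \bar R).
Hypothesis mu0 : mu set0 = 0%E.
Hypothesis mu_ge0 : forall A, (0 <= mu A)%E.
Hypothesis mu_add : semi_sigma_additive mu.
Hypothesis mu_fin : sigma_finite setT mu.

Let mu' := mu.
HB.instance Definition _ := isMeasure.Build _ _ _ mu' mu0 mu_ge0 mu_add.
HB.instance Definition _ := Measure_isSigmaFinite.Build _ _ _ mu' mu_fin.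

Lemma pack_sigma_finite :
  {m : {sigma_finite_measure set T -> \bar R} | mu = m}.
Proof. by exists mu'. Qed.

End pack_sigma_finite.

Section lebesgue_rV.
Context {R : realType}.

Definition cons_rV n (p : R * 'rV[R]_n) : 'rV[R]_n.+1 :=
  \row_i (if unlift ord0 i is Some j then p.2 ord0 j else p.1).

Fixpoint lebesgue_rV n : set 'rV[R]_n -> \bar R :=
  match n with
  | 0 => \d_(0 : 'rV[R]_0)
  | m.+1 => pushforward (lebesgue_measure \x lebesgue_rV (n := m))%E
              (@cons_rV m)
  end.

Lemma measurable_cons_rV n : measurable_fun setT (@cons_rV n).
Proof.
apply: measurable_fun_rV => i; rewrite /cons_rV.
under eq_fun do rewrite mxE.
case: (unlift ord0 i) => [j|]; last exact: measurable_fst.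
by apply: (@measurableT_comp _ _ _ _ _ _ (@rV_coord R n j) _ snd) => //;
  exact: measurable_rV_coord.
Qed.

Let uncons_rV n (x : 'rV[R]_n.+1) : R * 'rV[R]_n :=
  (x ord0 ord0, \row_j x ord0 (lift ord0 j)).

Let cons_rVK n : cancel (@cons_rV n) (@uncons_rV n).
Proof.
move=> [a y]; rewrite /uncons_rV /cons_rV !mxE unlift_none /=; congr (_, _).
by apply/rowP => j; rewrite !mxE liftK.
Qed.

Let measurable_uncons_rV n : measurable_fun setT (@uncons_rV n).
Proof.
apply: measurable_fun_pair; first exact: measurable_rV_coord.
apply: measurable_fun_rV => i.
under eq_fun do rewrite mxE.
exact: measurable_rV_coord.
Qed.

Let lebesgue_rV_spec n :
  {m : {sigma_finite_measure set 'rV[R]_n -> \bar R} | lebesgue_rV (n := n) = m}.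
Proof.
elim: n => [|n [m mE]]; first by exists \d_(0 : 'rV[R]_0).
pose mu : set 'rV[R]_n.+1 -> \bar R :=
  pushforward (lebesgue_measure \x m)%E (@cons_rV n).
pose mc := @measurable_cons_rV n.
pose nu : {measure set 'rV[R]_n.+1 -> \bar R} :=
  measure_function_pushforward__canonical__measure_function_Measure
    (lebesgue_measure \x m)%E mc.
have mu0 : mu set0 = 0%E by exact: (measure0 nu).
have mu_ge0 A : (0 <= mu A)%E by exact: (measure_ge0 nu).
have mu_add : semi_sigma_additive mu by exact: (@measure_semi_sigma_additive _ _ _ nu).
have mu_fin : sigma_finite setT mu.
  have /sigma_finiteP[F [TF ndF Foo]] := sigma_finiteT (@lebesgue_measure R).
  have /sigma_finiteP[G [TG ndG Goo]] := sigma_finiteT m.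
  exists (fun i => @uncons_rV n @^-1` (F i `*` G i)).
    rewrite -preimage_bigcup -[LHS](preimage_setT (@uncons_rV n)).
    congr (_ @^-1` _); rewrite -setXTT TF TG predeqE => -[x y]; split.
      move=> [/= [i _ Fix] [j _ Gjy]]; exists (maxn i j) => //; split.
      - by move: x Fix; exact/subsetPset/ndF/leq_maxl.
      - by move: y Gjy; exact/subsetPset/ndG/leq_maxr.
    by move=> [i _ []/= ? ?]; split; exists i.
  move=> i; have [? ?] := Foo i; have [? ?] := Goo i; split.
    rewrite -[X in measurable X]setTI; apply: measurable_uncons_rV => //.
    exact: measurableX.
  rewrite /mu /pushforward -comp_preimage.
  rewrite (_ : _ \o _ = id) ?preimage_id; last first.
    by apply/funext => x /=; rewrite cons_rVK.
  by rewrite product_measure1E// lte_mul_pinfty// ge0_fin_numE.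
have [M ME] := pack_sigma_finite mu0 mu_ge0 mu_add mu_fin.
by exists M; rewrite /= mE.
Qed.

Section instances.
Variable n : nat.
Local Notation leb := (@lebesgue_rV n).

Let leb0 : leb set0 = 0%E.
Proof. by rewrite (svalP (lebesgue_rV_spec n)) measure0. Qed.

Let leb_ge0 A : (0 <= leb A)%E.
Proof. by rewrite (svalP (lebesgue_rV_spec n)) measure_ge0. Qed.

Let leb_add : semi_sigma_additive leb.
Proof.
rewrite (svalP (lebesgue_rV_spec n)); exact: measure_semi_sigma_additive.
Qed.

HB.instance Definition _ := isMeasure.Build _ _ _ leb leb0 leb_ge0 leb_add.

Let leb_sigma_finite : sigma_finite setT leb.
Proof. rewrite (svalP (lebesgue_rV_spec n)); exact: sigma_finiteT. Qed.

HB.instance Definition _ := Measure_isSigmaFinite.Build _ _ _ leb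
  leb_sigma_finite.

End instances.
End lebesgue_rV.

Section image_measure.
Context {R : realType} d d' (T : measurableType d) (T' : measurableType d').
Variables (mu : {measure set T -> \bar R}) (f : {mfun T >-> T'}).

Definition image_measure : set T' -> \bar R := pushforward mu f.

Let image_measure0 : image_measure set0 = 0%E.
Proof. by rewrite /image_measure /pushforward preimage_set0 measure0. Qed.

Let image_measure_ge0 A : (0 <= image_measure A)%E.
Proof. by rewrite /image_measure /pushforward measure_ge0. Qed.

Let image_measure_add : semi_sigma_additive image_measure.
Proof.
move=> F mF tF mUF; rewrite /image_measure /pushforward preimage_bigcup.
apply: measure_semi_sigma_additive.
- by move=> i; rewrite -[X in measurable X]setTI; exact: measurable_funPT.
- apply/trivIsetP => /= i j _ _ ij; rewrite -preimage_setI.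
  by move/trivIsetP : tF => /(_ _ _ _ _ ij) ->//; rewrite preimage_set0.
- by rewrite -preimage_bigcup -[X in measurable X]setTI; exact: measurable_funPT.
Qed.

HB.instance Definition _ := isMeasure.Build _ _ _ image_measure
  image_measure0 image_measure_ge0 image_measure_add.

End image_measure.

Section euclidean.
Context {R : realType}.

Definition enorm n (x : 'rV[R]_n) : R := Num.sqrt (\sum_i x ord0 i ^+ 2).

Definition euclidean_ball n : set 'rV[R]_n := [set x | enorm x <= 1].

Definition sphere n : set 'rV[R]_n := [set x | enorm x = 1].

Definition normalize n (x : 'rV[R]_n) : 'rV[R]_n := (enorm x)^-1 *: x.

Lemma measurable_enorm n : measurable_fun setT (@enorm n).
Proof.
apply: (@measurableT_comp _ _ _ _ _ _ (@Num.sqrt R)).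
  by apply: continuous_measurable_fun; exact: sqrt_continuous.
apply: measurable_sum => i; apply: measurable_funX.
exact: measurable_rV_coord.
Qed.

Lemma measurable_euclidean_ball n : measurable (@euclidean_ball n).
Proof.
rewrite (_ : @euclidean_ball n = @enorm n @^-1` `]-oo, 1%R]).
  rewrite -[X in measurable X]setTI.
  by apply: measurable_enorm => //; exact: measurable_itv.
by apply/seteqP; split => x /=; rewrite in_itv.
Qed.

Lemma measurable_normalize n : measurable_fun setT (@normalize n).
Proof.
apply: measurable_fun_rV => i; rewrite /normalize.
under eq_fun do rewrite mxE -powR_inv1 ?sqrtr_ge0//.
apply: measurable_funM; last exact: measurable_rV_coord.
apply: (@measurableT_comp _ _ _ _ _ _ (@powR R ^~ (-1))).
  exact: measurable_powR.
exact: measurable_enorm.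
Qed.

HB.instance Definition _ n := isMeasurableFun.Build _ _ _ _ (@normalize n)
  (@measurable_normalize n).

(* The surface measure of the unit sphere of R^n: n times the volume of the
   cone {t x | x in A, 0 < t <= 1} over A.  For n = 1 it is the counting measure
   of {-1, 1}. *)
Definition sphere_measure n : {measure set 'rV[R]_n -> \bar R} :=
  mscale n%:R%:nng (image_measure
    (mrestr (@lebesgue_rV R n) (@measurable_euclidean_ball n)) (@normalize n)).

End euclidean.
Arguments lebesgue_rV {R} n _.
Arguments euclidean_ball {R} n _.
Arguments sphere {R} n _.
Arguments sphere_measure {R} n.

Section linear_subspace.
Context {R : realType} (n : nat).
Implicit Types H : {vspace 'rV[R]_n}.

Let sqnorm_gt0 (v : 'rV[R]_n) : v != 0 -> 0 < (v *m v^T) ord0 ord0.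
Proof.
move=> v0; rewrite mxE.
have -> : \sum_j v ord0 j * v^T j ord0 = \sum_j v ord0 j ^+ 2.
  by apply: eq_bigr => j _; rewrite mxE expr2.
rewrite lt_neqAle sumr_ge0 ?andbT => [|j _]; last exact: sqr_ge0.
apply: contra v0; rewrite eq_sym psumr_eq0 => [|j _]; last exact: sqr_ge0.
move=> /allP v0; apply/eqP/rowP => j; rewrite mxE.
by apply/eqP; rewrite -sqrf_eq0; exact: (implyP (v0 j (mem_index_enum _))).
Qed.

Lemma orthonormal_basis_exists m H : \dim H = m ->
  exists U : 'M[R]_(m, n), U *m U^T = 1%:M /\ forall i, row i U \in H.
Proof.
elim: m H => [|m IH] H Hm.
  by exists 0; split => [|[]//]; apply/matrixP => -[].
pose v := vpick H.
have vH : v \in H by exact: memv_pick.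
have v0 : v != 0 by rewrite vpick0 -dimv_eq0 Hm.
pose phi (x : 'rV[R]_n) : R^o := (x *m v^T) ord0 ord0.
have phi_lin : linear phi by move=> a x y; rewrite /phi mulmxDl -scalemxAl !mxE.
pose phiL := GRing.isLinear.Build _ _ _ _ phi phi_lin.
pose phi' : {linear 'rV[R]_n -> R^o} := HB.pack phi phiL.
pose f := linfun phi'.
have fE x : f x = phi x by rewrite /f lfunE.
have dimf : \dim (f @: H)%VS = 1%N.
  apply/anti_leq/andP; split; first by rewrite (leq_trans (dimvS (subvf _))) // dimvf.
  rewrite lt0n dimv_eq0; apply/eqP => fH0.
  have := memv_img f vH; rewrite fH0 memv0 fE => /eqP phiv.
  by have := sqnorm_gt0 v0; rewrite -/(phi v) phiv ltxx.
have := limg_ker_dim f H; rewrite dimf Hm addn1 => -[Hker].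
have [U [UU UH]] := IH _ Hker.
pose c := (v *m v^T) 0 0.
have c0 : 0 < c by exact: sqnorm_gt0.
pose w := (Num.sqrt c)^-1 *: v.
have wwT : w *m w^T = 1%:M.
  apply/matrixP => i j; rewrite !ord1 /w linearZ /= -scalemxAl -scalemxAr scalerA.
  rewrite [LHS]mxE [RHS]mxE eqxx -/c -expr2.
  by rewrite exprVn sqr_sqrtr ?ltW// mulVf ?gt_eqF.
have UwT : U *m w^T = 0.
  apply/matrixP => i j; rewrite !ord1 !mxE.
  have := UH i; rewrite memv_cap => /andP[_]; rewrite memv_ker fE /phi => /eqP.
  rewrite /w linearZ /= => E.
  transitivity ((Num.sqrt c)^-1 * ((row i U *m v^T) ord0 ord0)); last by rewrite E mulr0.
  by rewrite mxE mulr_sumr; apply: eq_bigr => k _; rewrite !mxE mulrCA.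
pose V : 'M[R]_(1 + m, n) := col_mx w U.
have VV : V *m V^T = 1%:M.
  rewrite tr_col_mx mul_col_row wwT UU UwT.
  rewrite -[w *m U^T]trmxK trmx_mul trmxK UwT trmx0.
  by rewrite -scalar_mx_block.
suff VH (i : 'I_(1 + m)) : row i V \in H by exists V.
rewrite -(splitK i); case: (fintype.split i) => j /=.
  rewrite rowKu (_ : row j w = w) ?memvZ//.
  by apply/rowP => k; rewrite mxE ord1.
by rewrite rowKd; have := UH j; rewrite memv_cap => /andP[].
Qed.

(* A matrix whose rows form an orthonormal basis of H. *)
Definition onbasis H : 'M[R]_(\dim H, n) :=
  xget 0 [set U | U *m U^T = 1%:M /\ forall i, row i U \in H].

Lemma onbasisP H :
  onbasis H *m (onbasis H)^T = 1%:M /\ forall i, row i (onbasis H) \in H.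
Proof. exact: (xgetPex 0 (orthonormal_basis_exists (erefl (\dim H)))). Qed.

Definition isometry_onto H (y : 'rV[R]_(\dim H)) : 'rV[R]_n := y *m onbasis H.

Lemma measurable_isometry_onto H : measurable_fun setT (@isometry_onto H).
Proof.
apply: measurable_fun_rV => j; rewrite /isometry_onto.
under eq_fun do rewrite mxE.
apply: measurable_sum => i; apply: measurable_funM => //.
exact: measurable_rV_coord.
Qed.

HB.instance Definition _ H := isMeasurableFun.Build _ _ _ _ (@isometry_onto H)
  (@measurable_isometry_onto H).

(* Lebesgue measure on H and the surface measure of the unit sphere of H, as
   measures on R^n concentrated on H.  They do not depend on the choice of the
   orthonormal basis, as lebesgue_rV is invariant under orthogonal maps. *)
Definition lebesgue_on H : {measure set 'rV[R]_n -> \bar R} :=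
  image_measure (lebesgue_rV (\dim H)) (@isometry_onto H).

Definition sphere_measure_on H : {measure set 'rV[R]_n -> \bar R} :=
  image_measure (sphere_measure (\dim H)) (@isometry_onto H).

Definition orth_proj H : 'M[R]_n := (onbasis H)^T *m onbasis H.

End linear_subspace.

(* The linear subspaces of R^n carry the topology of their orthogonal
   projections, which on each Gr n m is the usual one. *)
HB.instance Definition _ (R : realType) (n : nat) :=
  isPointed.Build {vspace 'rV[R]_n} 0%VS.
HB.instance Definition _ (R : realType) (n : nat) :=
  Topological.copy {vspace 'rV[R]_n} (initial_topology (@orth_proj R n)).

Definition Gr (R : realType) (n m : nat) : set {vspace 'rV[R]_n} :=
  [set H | \dim H = m].
Arguments Gr {R} n m _.

Section star_bodies.
Context {R : realType} (n : nat).
Implicit Types K L D : set 'rV[R]_n.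

Definition volume K : R := fine (lebesgue_rV n K).

Definition boundary K : set 'rV[R]_n := closure K `\` interior K.

(* For a star body K, the infimum is attained. *)
Definition minkowski_functional K (x : 'rV[R]_n) : R :=
  inf [set a | 0 <= a /\ [set a *: y | y in K] x].

Definition star_body K :=
  [/\ closed K, bounded_set K,
      forall u : 'rV[R]_n, u != 0 -> exists x y : 'rV[R]_n,
        x <> y /\
        ([set t *: u | t in [set: R]] `&` boundary K) `\` [set 0] = [set x; y],
      interior K 0 &
      continuous (minkowski_functional K)].

Definition origin_symmetric K := forall x, K x -> K (- x).

Definition spherical_radon (h : 'rV[R]_n -> R) (H : {vspace 'rV[R]_n}) : R :=
  \int[sphere_measure_on H]_(x in sphere n `&` [set` H]) h x.

(* A finite Borel measure on Gr n (n - k) is given as a finite Borel measure on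
   the space of all linear subspaces of R^n, used only on Gr n (n - k). *)
Definition gen_intersection_body (k : nat) D :=
  [/\ star_body D, origin_symmetric D &
      exists nu : {finite_measure set
          (g_sigma_algebraType (@open {vspace 'rV[R]_n})) -> \bar R},
        forall h : 'rV[R]_n -> R, {within sphere n, continuous h} ->
          \int[sphere_measure n]_(x in sphere n)
            ((minkowski_functional D x) ^- k * h x) =
          \int[nu]_(H in Gr n (n - k)%N) spherical_radon h H].

(* An extended real, so that the infimum of an empty family is +oo. *)
Definition d_ovr K (Omega : set (set 'rV[R]_n)) : \bar R :=
  ereal_inf [set ((volume D / volume K) `^ n%:R^-1)%:E |
    D in [set D | K `<=` D /\ Omega D]].

End star_bodies.
Arguments gen_intersection_body {R n} k D.

(* Main.v *)
(* Write F = f on K and G = g on L, extended by 0, m = n - k, |.|_D for the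
   gauge of D, and h_F(x) = int_0^oo r^(m-1) F(rx) dr.  In polar coordinates the
   section integral of F by H is the Radon transform of h_F at H, so that
   R h_F <= eps R h_G on the Grassmannian, where eps is the maximal ratio of
   section integrals.  It is attained: the section integral of F by the row space
   of an orthonormal U is a continuous function of U in the compact Stiefel
   manifold, which by invariance of Lebesgue measure under orthogonal maps does
   not depend on the basis.  For D in BP_k containing K, integrating against the
   measure of D yields

     int F <= int_S |.|_D^-k h_F <= eps int_S |.|_D^-k h_G
            = eps int |x|_D^-k G(x) dx,

   and since 0 <= G <= 1 the last integral is at most the one where G is replaced
   by the indicator of the dilate of D of volume int G (bathtub principle), which
   is n/m |D|^(k/n) (int G)^(m/n). *)

Require Import Defs.
From HB Require Import structures.
From mathcomp Require Import all_boot all_order all_algebra.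
From mathcomp Require Import all_classical all_reals all_analysis.
From mathcomp Require Import measurable_realfun.
From mathcomp Require Import ring lra.

Set Implicit Arguments.
Unset Strict Implicit.
Unset Printing Implicit Defensive.

Import Order.TTheory GRing.Theory Num.Theory.
Import numFieldNormedType.Exports.

Local Open Scope classical_set_scope.
Local Open Scope ring_scope.

(** * Lebesgue measure on row vectors *)

(** The obstacle is continuity. F may jump at the boundary of K, while the identity that defines D
    in BP_k is tested only on functions continuous on the sphere, and the maximum requires section
    integrals that vary continuously. Two devices remove the jump. First f is extended continuously
    to the whole space by composition with the radial retraction onto K. Then r = s/|x|_K is
    substituted in h_F, which gives |x|_K^-m int_0^1 s^(m-1) f(s x/|x|_K) ds: the interval is fixed,
    and the result is continuous off the origin. Radon transforms are compared against the measure
    of D as lower integrals. Real-valued integrals read an infinite value as 0, so these comparisons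
    come with finiteness proofs, which rest on bounds over compact sets. The ratio eps = 0 is
    treated apart: the distance is an extended real and +oo * 0 = 0, so int F = 0 is then proved
    directly. For eps > 0 the bound is shown for each D and passes to the infimum through k-th
    roots. *)

Lemma measurable_rV_box (R : realType) n (q : 'rV[R]_n) (r : R) :
  measurable [set x : 'rV[R]_n | forall i, `|q ord0 i - x ord0 i| < r].
Proof.
rewrite (_ : mkset _ =
    \bigcap_(i in [set: 'I_n]) (@rV_coord R n i @^-1` ball (q ord0 i) r)).
  apply: fin_bigcap_measurable => // i _.
  rewrite -[X in measurable X]setTI; apply: measurable_rV_coord => //.
  exact: measurable_ball.
apply/seteqP; split => x /=.
  by move=> xr i _; exact: xr.
by move=> xr i; exact: (xr i I).
Qed.

(** The link between the topology and the sigma-algebra generated by the coordinates: an open set is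
    the union of the countably many boxes with rational centre and radius that it contains. *)
Lemma open_measurable_rV (R : realType) n (A : set 'rV[R]_n) :
  open A -> measurable A.
Proof.
move=> oA.
pose B (p : 'rV[rat]_n * rat) : set 'rV[R]_n :=
  [set x | forall i, `|ratr (p.1 ord0 i) - x ord0 i| < ratr p.2].
have mB p : measurable (B p).
  have := measurable_rV_box (map_mx ratr p.1 : 'rV[R]_n) (ratr p.2).
  by congr measurable; apply/seteqP; split => x /= xr i; have := xr i;
     rewrite mxE.
rewrite (_ : A = \bigcup_p (if `[< B p `<=` A >] then B p else set0)).
  apply: (@countable_bigcupT_measurable _ _ ('rV[rat]_n * rat)%type).
    exact: countableP.
  by move=> p; case: ifPn.
apply/seteqP; split => [x Ax|x [p _]]; last by case: asboolP => // pA /pA.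
have /nbhs_ballP[e /= e0 xeA] : nbhs x A by exact: open_nbhs_nbhs.
have e2 : 0 < e / 2 by rewrite divr_gt0.
(* With r < e/2 and a centre within r of x, every point of the box is within 2r < e of x. *)
have [r] := rat_in_itvoo e2; rewrite in_itv/= => /andP[r0 re].
have /choice[q qr] : forall i, exists q : rat, `|ratr q - x ord0 i| < ratr r :> R.
  move=> i; have : x ord0 i - ratr r < x ord0 i + ratr r by lra.
  move=> /rat_in_itvoo[q]; rewrite in_itv/= => qI; exists q.
  by rewrite ltr_distl.
exists (\row_i q i, r) => //.
case: asboolP => [_ i|]; first by rewrite /= mxE.
case; move=> y /= By; apply: xeA; split => // i j.
rewrite !ord1 /= /ball /=.
have := By j; have := qr j; rewrite mxE => h1 h2.
rewrite (le_lt_trans (ler_distD (ratr (q j)) _ _))// distrC.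
by rewrite (lt_trans (ltrD h1 h2))//; lra.
Qed.

Lemma closed_measurable_rV (R : realType) n (A : set 'rV[R]_n) :
  closed A -> measurable A.
Proof.
by move=> /closed_openC/open_measurable_rV/measurableC; rewrite setCK.
Qed.

Lemma continuous_measurable_fun_rV (R : realType) n (f : 'rV[R]_n -> R) :
  continuous f -> measurable_fun setT f.
Proof.
move=> cf; apply: (measurability _ (RGenOpens.measurableE R)).
move=> _ [_ [a [b ->] <-]]; rewrite setTI; apply: open_measurable_rV.
by move/continuousP : cf; apply; exact: interval_open.
Qed.

(** The image measure scaled by c agrees with Lebesgue measure on half-open intervals, and
    uniqueness applies. *)
Lemma lebesgue_measure_affine (R : realType) (c t : R) (A : set R) : 0 < c ->
  measurable A ->
  (c%:E * lebesgue_measure ((fun r => (c * r + t)%R) @^-1` A) =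
   lebesgue_measure A)%E.
Proof.
move=> c0 mA.
have mphi : measurable_fun setT (fun r : R => c * r + t : measurableTypeR R).
  by apply: measurable_funD => //; exact: measurable_funM.
pose nu : {measure set (measurableTypeR R) -> \bar R} :=
  mscale (NngNum (ltW c0))
   (measure_function_pushforward__canonical__measure_function_Measure
    (@lebesgue_measure R) mphi).
suff -> : lebesgue_measure A = nu A by [].
apply: lebesgue_measure_unique => // _ [[a b] _ <-] /=.
rewrite /nu /mscale /= /pushforward.
rewrite (_ : _ @^-1` _ = `](a - t) / c, (b - t) / c]%classic); last first.
  apply/seteqP; split => r /=; rewrite !in_itv/= ltr_pdivrMr// ler_pdivlMr//;
  by rewrite ltrBlDr lerBrDr mulrC.
rewrite !lebesgue_measure_itv/= !lte_fin ltr_pM2r ?invr_gt0// ltrD2r.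
case: ifPn => _; last by rewrite mule0.
by rewrite -!EFinD -EFinM; congr EFin; field; rewrite gt_eqF.
Qed.

Lemma ge0_integral_affine (R : realType) (c t : R) (F : R -> \bar R) : 0 < c ->
  measurable_fun setT F -> (forall x, 0 <= F x)%E ->
  (\int[lebesgue_measure]_x F (c * x + t)%R =
   (c^-1)%:E * \int[lebesgue_measure]_x F x)%E.
Proof.
move=> c0 mF F0.
have mphi : measurable_fun setT (fun r : R => c * r + t : measurableTypeR R).
  by apply: measurable_funD => //; exact: measurable_funM.
have H : (\int[lebesgue_measure]_x F x =
    \int[mscale (NngNum (ltW c0))
   (measure_function_pushforward__canonical__measure_function_Measure
    (@lebesgue_measure R) mphi)]_x F x)%E.
  apply: eq_measure_integral => A mA _.
  exact: (esym (lebesgue_measure_affine t c0 mA)).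
rewrite H ge0_integral_mscale//= ge0_integral_pushforward// preimage_setT.
by rewrite muleA -EFinM mulVf ?gt_eqF// mul1e.
Qed.

Lemma integral_cons_rV (R : realType) m (F : 'rV[R]_m.+1 -> \bar R) :
  measurable_fun setT F -> (forall x, 0 <= F x)%E ->
  (\int[lebesgue_rV m.+1]_x F x =
   \int[lebesgue_measure]_t \int[lebesgue_rV m]_y F (cons_rV (t, y)))%E.
Proof.
move=> mF F0.
have mc := @measurable_cons_rV R m.
transitivity (\int[pushforward (lebesgue_measure \x lebesgue_rV m) (@cons_rV R m)]_x F x)%E.
  by apply: eq_measure_integral.
rewrite ge0_integral_pushforward// preimage_setT.
pose G : measurableTypeR R * 'rV[R]_m -> \bar R := F \o @cons_rV R m.
have mG : measurable_fun setT G by exact: measurableT_comp.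
have G0 x : (0 <= G x)%E by exact: F0.
exact: (@fubini_tonelli1 _ _ (measurableTypeR R) 'rV[R]_m R
  lebesgue_measure (lebesgue_rV m) G mG G0).
Qed.

Lemma measurable_fun_slice (R : realType) m (F : 'rV[R]_m.+1 -> \bar R) (a : R) :
  measurable_fun setT F -> measurable_fun setT (fun y => F (cons_rV (a, y))).
Proof.
move=> mF; apply: (measurableT_comp mF).
apply: measurable_fun_rV => i.
under eq_fun do rewrite mxE/=.
by case: (unlift _ _) => [j|]; [exact: (measurable_rV_coord j)|exact: measurable_cst].
Qed.

Lemma measurable_fun_slice_integral (R : realType) m (F : 'rV[R]_m.+1 -> \bar R) :
  measurable_fun setT F -> (forall x, 0 <= F x)%E ->
  measurable_fun setT
    (fun a : R => (\int[lebesgue_rV m]_y F (cons_rV (a, y)))%E).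
Proof.
move=> mF F0.
pose G : measurableTypeR R * 'rV[R]_m -> \bar R := F \o @cons_rV R m.
have mG : measurable_fun setT G.
  by apply: (measurableT_comp mF); exact: measurable_cons_rV.
have G0 x : (0 <= G x)%E by exact: F0.
exact: (@measurable_fun_fubini_tonelli_F _ _ (measurableTypeR R) 'rV[R]_m R
  (lebesgue_rV m) G mG G0).
Qed.

Lemma measurable_affine_rV (R : realType) m (c : R) (t : 'rV[R]_m) :
  measurable_fun setT (fun x : 'rV[R]_m => c *: x + t).
Proof.
apply: measurable_fun_rV => i.
under eq_fun do rewrite mxE mxE.
apply: measurable_funD => //; apply: measurable_funM => //.
exact: (measurable_rV_coord i).
Qed.

Lemma affine_cons_rV (R : realType) m (c a : R) (y : 'rV[R]_m) (t : 'rV[R]_m.+1) :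
  c *: cons_rV (a, y) + t =
  cons_rV (c * a + t ord0 ord0, c *: y + \row_j t ord0 (lift ord0 j)).
Proof.
apply/rowP => i; rewrite !mxE /=.
by case: unliftP => [j ->|->]; rewrite ?mxE.
Qed.

(** Induction on the dimension through Tonelli: each coordinate contributes one factor c^-1, and the
    tail of t is the translation in the induction hypothesis. *)
Lemma ge0_integral_affine_rV (R : realType) m (c : R) (t : 'rV[R]_m)
    (F : 'rV[R]_m -> \bar R) : 0 < c ->
  measurable_fun setT F -> (forall x, 0 <= F x)%E ->
  (\int[lebesgue_rV m]_x F (c *: x + t)%R =
   ((c^-1) ^+ m)%:E * \int[lebesgue_rV m]_x F x)%E.
Proof.
move=> c0; elim: m t F => [|m IH] t F mF F0.
  rewrite expr0 mul1e; apply: eq_integral => x _; congr F.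
  by apply/rowP => -[].
have cF : measurable_fun setT (fun x : 'rV[R]_m.+1 => F (c *: x + t)).
  by apply: (measurableT_comp mF); exact: measurable_affine_rV.
rewrite integral_cons_rV// integral_cons_rV//.
pose P a := (\int[lebesgue_rV m]_y F (cons_rV (a, y)))%E.
have mP : measurable_fun setT P by exact: measurable_fun_slice_integral.
have P0 a : (0 <= P a)%E by apply: integral_ge0 => *; exact: F0.
transitivity (\int[lebesgue_measure]_a
    ((c^-1 ^+ m)%:E * P (c * a + t ord0 ord0)%R))%E.
  apply: eq_integral => a _.
  under eq_integral do rewrite affine_cons_rV.
  apply: (IH _ (fun y => F (cons_rV ((c * a + t ord0 ord0)%R, y)))) => //.
  exact: measurable_fun_slice.
have mPc : measurable_fun setT (fun a : measurableTypeR R => P (c * a + t ord0 ord0)).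
  apply: (measurableT_comp mP).
  by apply: measurable_funD => //; exact: measurable_funM.
rewrite ge0_integralZl//; last by rewrite lee_fin exprn_ge0// invr_ge0 ltW.
rewrite (ge0_integral_affine (t ord0 ord0) c0 mP P0).
by rewrite muleA -EFinM -exprSr.
Qed.

Lemma integral_indicT d (T : measurableType d) (R : realType)
    (mu : {measure set T -> \bar R}) (A : set T) : measurable A ->
  (\int[mu]_x (\1_A x)%:E = mu A)%E.
Proof. by move=> mA; rewrite integral_indic// setIT. Qed.

(** A reference set of known volume. Its affine images bound the volume of bounded sets from above
    and that of open sets from below. *)
Definition rV_cube (R : realType) m : set 'rV[R]_m :=
  [set x | forall i, `|x ord0 i| <= 1].

Lemma measurable_rV_cube (R : realType) m : measurable (@rV_cube R m).
Proof.
rewrite (_ : @rV_cube R m =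
    \bigcap_(i in [set: 'I_m]) (@rV_coord R m i @^-1` `[-1, 1]%classic)).
  apply: fin_bigcap_measurable => // i _.
  by rewrite -[X in measurable X]setTI; apply: measurable_rV_coord.
apply/seteqP; split => x /=.
  by move=> xr i _; rewrite /= in_itv/= -ler_norml; exact: xr.
by move=> xr i; have := xr i I; rewrite /= in_itv/= -ler_norml.
Qed.

Lemma lebesgue_rV_cube (R : realType) m :
  lebesgue_rV m (@rV_cube R m) = (2 ^+ m)%:E.
Proof.
elim: m => [|m IH].
  have c0 : rV_cube (0 : 'rV[R]_0) by case.
  by rewrite /= diracE mem_set.
rewrite -(integral_indicT (lebesgue_rV m.+1) (@measurable_rV_cube R m.+1)).
rewrite integral_cons_rV; last 2 first.
- by apply/measurable_EFinP/measurable_indic; exact: measurable_rV_cube.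
- by move=> x; rewrite lee_fin.
transitivity (\int[lebesgue_measure]_(t in `[(-1)%R, 1%R]) (2 ^+ m : R)%:E)%E.
  rewrite [RHS]integral_mkcond; apply: eq_integral => t _.
  rewrite [RHS]patchE; case: ifPn => tI.
    rewrite -IH -(integral_indicT (lebesgue_rV m) (@measurable_rV_cube R m)).
    apply: eq_integral => y _; rewrite !indicE; congr ((_ : bool)%:R%:E).
    apply/idP/idP => /set_mem h; apply/mem_set => i.
      by have := h (lift ord0 i); rewrite mxE liftK.
    rewrite mxE /=; case: unliftP => [j _|_]; first exact: h.
    by move/set_mem : tI; rewrite /= in_itv/= -ler_norml.
  rewrite integral0_eq// => y _; rewrite indicE memNset// => /(_ ord0).
  rewrite mxE unlift_none/= => h.
  by move/negP : tI; apply; apply/mem_set; rewrite /= in_itv/= -ler_norml.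
rewrite integral_cst//= lebesgue_measure_itv/= lte_fin ifT; last by lra.
by rewrite -EFinD -EFinM exprSr; congr (_ * _)%:E; lra.
Qed.

Lemma rV_cube_affine (R : realType) m (e : R) (t : 'rV[R]_m) : 0 < e ->
  lebesgue_rV m [set x : 'rV[R]_m | forall i, `|x ord0 i - t ord0 i| <= e] =
  ((2 * e) ^+ m)%:E.
Proof.
move=> e0.
set A := mkset _.
have Ai : A = (fun x : 'rV[R]_m => e^-1 *: x + (- (e^-1 *: t))) @^-1` @rV_cube R m.
  apply/seteqP; split => x /= h i; have := h i; rewrite !mxE -mulrBr normrM;
    by rewrite gtr0_norm ?invr_gt0// mulrC ler_pdivrMr// mul1r.
have mA : measurable A.
  rewrite Ai -[X in measurable X]setTI; apply: measurable_affine_rV => //.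
  exact: measurable_rV_cube.
rewrite -(integral_indicT _ mA).
transitivity (\int[lebesgue_rV m]_x
  (\1_(@rV_cube R m) (e^-1 *: x + (- (e^-1 *: t))))%:E)%E.
  by apply: eq_integral => x _; rewrite Ai.
rewrite (@ge0_integral_affine_rV _ _ e^-1 _ (fun x => (\1_(@rV_cube R m) x)%:E)).
- rewrite integral_indicT; last exact: measurable_rV_cube.
  have := lebesgue_rV_cube R m; rewrite /= => ->.
  by rewrite -EFinM invrK -exprMn mulrC.
- by rewrite invr_gt0.
- by apply/measurable_EFinP/measurable_indic; exact: measurable_rV_cube.
- by move=> x; rewrite lee_fin.
Qed.

Lemma lebesgue_rV_bounded (R : realType) m (M : R) (A : set 'rV[R]_m) :
  measurable A -> (forall x i, A x -> `|x ord0 i| <= M) ->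
  (lebesgue_rV m A < +oo)%E.
Proof.
move=> mA AM; pose e := Num.max M 1.
have e0 : 0 < e by rewrite lt_max ltr01 orbT.
pose B : set 'rV[R]_m := [set x | forall i, `|x ord0 i - (0 : 'rV[R]_m) ord0 i| <= e].
have BE : lebesgue_rV m B = ((2 * e) ^+ m)%:E by exact: rV_cube_affine.
have Be : B = \bigcap_(i in [set: 'I_m]) (@rV_coord R m i @^-1` `[- e, e]%classic).
  apply/seteqP; split => x /= h i; last first.
    by have := h i I; rewrite /= in_itv/= -ler_norml mxE subr0.
  by move=> _; have := h i; rewrite /= in_itv/= -ler_norml mxE subr0.
apply: (@le_lt_trans _ _ (lebesgue_rV m B)); last by rewrite BE ltry.
apply: le_measure; rewrite ?inE//.
  rewrite Be; apply: fin_bigcap_measurable => // i _.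
  by rewrite -[X in measurable X]setTI; apply: measurable_rV_coord.
move=> x Ax i; rewrite mxE subr0 (le_trans (AM _ i Ax))//.
by rewrite le_max lexx.
Qed.

Lemma lebesgue_rV_open_gt0 (R : realType) m (A : set 'rV[R]_m) (x : 'rV[R]_m) :
  open A -> A x -> (0 < lebesgue_rV m A)%E.
Proof.
move=> oA Ax.
have /nbhs_ballP[e /= e0 xeA] : nbhs x A by exact: open_nbhs_nbhs.
pose B := [set y : 'rV[R]_m | forall i, `|y ord0 i - x ord0 i| <= e / 2].
have e2 : 0 < e / 2 by rewrite divr_gt0.
have BE : lebesgue_rV m B = ((2 * (e / 2)) ^+ m)%:E by exact: rV_cube_affine.
apply: (@lt_le_trans _ _ (lebesgue_rV m B)).
  by rewrite BE lte_fin exprn_gt0// mulr_gt0.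
apply: le_measure; rewrite ?inE.
- rewrite (_ : B = \bigcap_(i in [set: 'I_m])
    (@rV_coord R m i @^-1` `[x ord0 i - e / 2, x ord0 i + e / 2]%classic)).
    apply: fin_bigcap_measurable => // i _.
    by rewrite -[X in measurable X]setTI; apply: measurable_rV_coord.
  apply/seteqP; split => y /= h i; last by have := h i I; rewrite /= in_itv/= -ler_distl.
  by move=> _; rewrite /= in_itv/= -ler_distl; exact: h.
- exact: open_measurable_rV.
- move=> y By; apply: xeA; split => // i j; rewrite !ord1 /ball/= distrC.
  by rewrite (le_lt_trans (By j))// ltr_pdivrMr// ltr_pMr// ltr1n.
Qed.

Lemma ge0_integral_gt0_open (R : realType) m (F : 'rV[R]_m -> \bar R)
    (V : set 'rV[R]_m) (x : 'rV[R]_m) (c : R) :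
  measurable_fun setT F -> (forall y, 0 <= F y)%E -> open V -> V x -> 0 < c ->
  (forall y, V y -> (c%:E <= F y)%E) -> (0 < \int[lebesgue_rV m]_y F y)%E.
Proof.
move=> mF F0 oV Vx c0 cF.
have mV := open_measurable_rV oV.
apply: (@lt_le_trans _ _ (\int[lebesgue_rV m]_(y in V) c%:E)%E).
  rewrite integral_cst// mule_gt0 ?lte_fin//=.
  exact: (lebesgue_rV_open_gt0 oV Vx).
rewrite [leLHS]integral_mkcond.
apply: ge0_le_integral => //.
- by move=> y _; rewrite patchE; case: ifP => // _; rewrite lee_fin ltW.
- by apply/(measurable_restrictT _ mV).
- by move=> y _; rewrite patchE; case: ifPn => // /set_mem /cF.
Qed.

(** The dilation by 2 fixes the origin, so its finite volume v satisfies v = 2^-(m+1) v. The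
    dimension is positive here; in dimension 0 the point has mass 1. *)
Lemma lebesgue_rV_set0 (R : realType) m : lebesgue_rV m.+1 [set 0 : 'rV[R]_m.+1] = 0%E.
Proof.
have m0 : measurable [set 0 : 'rV[R]_m.+1].
  apply: closed_measurable_rV; apply: accessible_closed_set1.
  exact/hausdorff_accessible/norm_hausdorff.
have oo : (lebesgue_rV m.+1 [set 0%R : 'rV[R]_m.+1] < +oo)%E.
  apply: (@lebesgue_rV_bounded _ _ 0) => // x i /= ->.
  by rewrite mxE normr0.
pose f (x : 'rV[R]_m.+1) : \bar R := (\1_[set 0] x)%:E.
have mf : measurable_fun setT f by exact/measurable_EFinP/measurable_indic.
have f0 x : (0 <= f x)%E by rewrite lee_fin.
have := ge0_integral_affine_rV 0 (ltr0Sn R 1) mf f0.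
rewrite (_ : (fun x => f (2 *: x + 0)) = f); last first.
  apply/funext => x; rewrite addr0 /f !indicE; congr ((_ : bool)%:R%:E).
  apply/idP/idP => /set_mem /= h; apply/mem_set => /=.
    by apply/eqP; move/eqP : h; rewrite scaler_eq0 pnatr_eq0.
  by rewrite h scaler0.
rewrite integral_indicT// => vE.
have scale0 (v : \bar R) : v \is a fin_num ->
    v = (((2^-1 : R) ^+ m.+1)%:E * v)%E -> v = 0%E.
  case: v => // r _; rewrite -EFinM => -[rE].
  have q1 : (2^-1 : R) ^+ m.+1 < 1 by rewrite exprn_ilt1// invf_lt1// ltr1n.
  congr EFin; apply/eqP; have /eqP : (1 - (2^-1 : R) ^+ m.+1) * r = 0.
    by rewrite mulrBl mul1r -rE subrr.
  by rewrite mulf_eq0 subr_eq0 gt_eqF.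
by apply: scale0 vE; rewrite ge0_fin_numE.
Qed.

Lemma cvg_sumr (R : realType) T (F : set_system T) (FF : Filter F)
    (I : Type) (r : seq I) (f : I -> T -> R) (a : I -> R) :
  (forall i, f i x @[x --> F] --> a i) ->
  (\sum_(i <- r) f i x) @[x --> F] --> \sum_(i <- r) a i.
Proof.
move=> fa; elim: r => [|i r IH].
  by rewrite big_nil; under eq_fun do rewrite big_nil; exact: cvg_cst.
rewrite big_cons; under eq_fun do rewrite big_cons.
exact: cvgD.
Qed.

(** * The Euclidean norm *)

Section enorm_theory.
Context {R : realType}.

Lemma enorm_sqr n (x : 'rV[R]_n) : enorm x ^+ 2 = (x *m x^T) ord0 ord0.
Proof.
rewrite sqr_sqrtr ?sumr_ge0// => [|i _]; last exact: sqr_ge0.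
by rewrite mxE; apply: eq_bigr => i _; rewrite mxE expr2.
Qed.

Lemma enorm_ge0 n (x : 'rV[R]_n) : 0 <= enorm x.
Proof. exact: sqrtr_ge0. Qed.

Lemma enorm_isometry m n (x : 'rV[R]_m) (U : 'M[R]_(m, n)) :
  U *m U^T = 1%:M -> enorm (x *m U) = enorm x.
Proof.
move=> UU; apply/eqP; rewrite -(@eqrXn2 _ 2) ?enorm_ge0//.
by rewrite !enorm_sqr trmx_mul mulmxA -(mulmxA x) UU mulmx1.
Qed.

Lemma enormZ n (c : R) (x : 'rV[R]_n) : 0 <= c -> enorm (c *: x) = c * enorm x.
Proof.
move=> c0; apply/eqP; rewrite -(@eqrXn2 _ 2) ?enorm_ge0 ?mulr_ge0 ?enorm_ge0//.
by rewrite exprMn !enorm_sqr linearZ/= -scalemxAl -scalemxAr !mxE mulrA expr2.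
Qed.

Lemma enormN n (x : 'rV[R]_n) : enorm (- x) = enorm x.
Proof.
by congr Num.sqrt; apply: eq_bigr => i _; rewrite mxE sqrrN.
Qed.

Lemma enorm0 n : enorm (0 : 'rV[R]_n) = 0.
Proof. by rewrite -(scale0r 0) enormZ// mul0r. Qed.

Lemma ler_coord_enorm n (x : 'rV[R]_n) i : `|x ord0 i| <= enorm x.
Proof.
rewrite -sqrtr_sqr ler_sqrt ?sumr_ge0// => [|j _]; last exact: sqr_ge0.
by rewrite (bigD1 i)//= lerDl sumr_ge0// => j _; exact: sqr_ge0.
Qed.

Lemma enorm_eq0 n (x : 'rV[R]_n) : (enorm x == 0) = (x == 0).
Proof.
apply/eqP/eqP => [x0|->]; last exact: enorm0.
apply/rowP => i; rewrite mxE; apply/eqP; rewrite -normr_le0 -x0.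
exact: ler_coord_enorm.
Qed.

Lemma enorm_gt0 n (x : 'rV[R]_n) : (0 < enorm x) = (x != 0).
Proof. by rewrite lt_neqAle enorm_ge0 andbT eq_sym enorm_eq0. Qed.

Lemma enorm_continuous n : continuous (@enorm R n).
Proof.
move=> x; apply: (@continuous_comp _ _ _ _ Num.sqrt); last exact: sqrt_continuous.
apply: (cvg_sumr (nbhs_filter x)) => i.
apply: (@continuous_comp _ _ _ (fun M : 'rV[R]_n => M ord0 i) (fun r : R => r ^+ 2)).
  exact: coord_continuous.
exact: exprn_continuous.
Qed.

End enorm_theory.

(** * Invariance of Lebesgue measure under orthogonal maps *)

Lemma mule_posI (R : realType) (a x y : \bar R) :
  (0 < a)%E -> (a < +oo)%E -> (a * x = a * y)%E -> x = y.
Proof.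
case: a => // a; rewrite lte_fin => a0 _ E.
have := congr1 (fun z => (a^-1)%:E * z)%E E.
by rewrite !muleA -EFinM mulVf ?gt_eqF// !mul1e.
Qed.

Lemma measurable_mulmxr (R : realType) m n (U : 'M[R]_(m, n)) :
  measurable_fun setT (fun y : 'rV[R]_m => y *m U).
Proof.
apply: measurable_fun_rV => j; under eq_fun do rewrite mxE.
apply: measurable_sum => i; apply: measurable_funM => //.
exact: (measurable_rV_coord i).
Qed.

Lemma measurable_funD_rV d (T : measurableType d) (R : realType) n
    (f g : T -> 'rV[R]_n) :
  measurable_fun setT f -> measurable_fun setT g ->
  measurable_fun setT (fun x => f x + g x).
Proof.
move=> mf mg; apply: measurable_fun_rV => i; under eq_fun do rewrite mxE.
apply: measurable_funD.
  exact: (measurableT_comp (measurable_rV_coord i) mf).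
exact: (measurableT_comp (measurable_rV_coord i) mg).
Qed.

Lemma ge0_integral_translate_rV (R : realType) m (t : 'rV[R]_m)
    (F : 'rV[R]_m -> \bar R) :
  measurable_fun setT F -> (forall x, 0 <= F x)%E ->
  (\int[lebesgue_rV m]_x F (x + t)%R = \int[lebesgue_rV m]_x F x)%E.
Proof.
move=> mF F0; have := ge0_integral_affine_rV t ltr01 mF F0.
rewrite invr1 expr1n mul1e => <-; apply: eq_integral => x _.
by rewrite scale1r.
Qed.

(* Tonelli applied to f(x) g(x + yO), for f the indicator of the Euclidean
   ball, which is even and invariant under O. *)
Lemma ge0_integral_orthogonal (R : realType) m (O : 'M[R]_m)
    (g : 'rV[R]_m -> \bar R) : O *m O^T = 1%:M ->
  measurable_fun setT g -> (forall x, 0 <= g x)%E ->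
  (\int[lebesgue_rV m]_y g (y *m O)%R = \int[lebesgue_rV m]_x g x)%E.
Proof.
move=> OO mg g0.
have OO' : O^T *m O = 1%:M by rewrite (mulmx1C OO).
have mO := measurable_mulmxr O.
pose f (x : 'rV[R]_m) : \bar R := (\1_(euclidean_ball m) x)%:E.
have mB := @measurable_euclidean_ball R m.
have mf : measurable_fun setT f by exact/measurable_EFinP/measurable_indic.
have f0 x : (0 <= f x)%E by rewrite lee_fin.
have fN x : f (- x) = f x.
  rewrite /f !indicE; congr ((_ : bool)%:R%:E).
  by apply/idP/idP => /set_mem h; apply/mem_set; move: h;
    rewrite /euclidean_ball /= enormN.
have fO x : f (x *m O) = f x.
  rewrite /f !indicE; congr ((_ : bool)%:R%:E).
  by apply/idP/idP => /set_mem h; apply/mem_set; move: h;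
    rewrite /euclidean_ball /= enorm_isometry.
have fE : (\int[lebesgue_rV m]_x f x)%E = lebesgue_rV m (euclidean_ball m).
  exact: integral_indicT.
have foo : (\int[lebesgue_rV m]_x f x < +oo)%E.
  rewrite fE; apply: (@lebesgue_rV_bounded _ _ 1) => // x i.
  exact/le_trans/ler_coord_enorm.
have fgt0 : (0 < \int[lebesgue_rV m]_x f x)%E.
  apply: (@ge0_integral_gt0_open _ _ _ [set x | enorm x < 1] 0 1) => //.
  - apply: (@open_comp _ _ (@enorm R m) [set r | r < 1]) => [x _|].
      exact: enorm_continuous.
    exact: open_lt.
  - by rewrite /= enorm0.
  - move=> y /= y1; rewrite /f indicE mem_set//= /euclidean_ball/=.
    exact: ltW.
(* Translating y by x O^T translates y O by x, so the unknown integral y -> g (y O) is itself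
   translation invariant. *)
have trans (h : 'rV[R]_m -> \bar R) (x : 'rV[R]_m) :
    measurable_fun setT h -> (forall x, 0 <= h x)%E ->
    (\int[lebesgue_rV m]_y h (y *m O + x)%R =
     \int[lebesgue_rV m]_y h (y *m O)%R)%E.
  move=> mh h0.
  rewrite -[RHS](@ge0_integral_translate_rV _ _ (x *m O^T)).
  - by apply: eq_integral => y _; rewrite mulmxDl -mulmxA OO' mulmx1.
  - exact: measurableT_comp.
  - by move=> y; exact: h0.
have mN : measurable_fun setT (fun x : 'rV[R]_m => - x).
  apply: measurable_fun_rV => i; under eq_fun do rewrite mxE.
  by apply: measurableT_comp => //; exact: (measurable_rV_coord i).
have m1 := @measurable_fst _ _ 'rV[R]_m 'rV[R]_m.
have m2 := @measurable_snd _ _ 'rV[R]_m 'rV[R]_m.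
(* Integrating [h] over y first gives A times the integral of g(yO), where A is the volume of the
   ball. For fixed y, the translation of x by yO turns [h] into [h'], whose integral over y first is
   A times the integral of g. Cancelling A, positive and finite, concludes. *)
pose h (p : 'rV[R]_m * 'rV[R]_m) : \bar R := (f p.1 * g (p.2 *m O + p.1)%R)%E.
have mh : measurable_fun setT h.
  apply: emeasurable_funM; first exact: (measurableT_comp mf m1).
  apply: (measurableT_comp mg); apply: measurable_funD_rV => //.
  exact: (measurableT_comp mO m2).
have h0 p : (0 <= h p)%E by rewrite mule_ge0.
pose h' (p : 'rV[R]_m * 'rV[R]_m) : \bar R := (f (p.2 *m O - p.1)%R * g p.1)%E.
have mh' : measurable_fun setT h'.
  apply: emeasurable_funM; last exact: (measurableT_comp mg m1).
  apply: (measurableT_comp mf); apply: measurable_funD_rV.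
    exact: (measurableT_comp mO m2).
  exact: (measurableT_comp mN m1).
have h'0 p : (0 <= h' p)%E by rewrite mule_ge0.
have E1 := @fubini_tonelli _ _ _ _ R (lebesgue_rV m) (lebesgue_rV m) h mh h0.
have E2 := @fubini_tonelli _ _ _ _ R (lebesgue_rV m) (lebesgue_rV m) h' mh' h'0.
have swap : (\int[lebesgue_rV m]_y \int[lebesgue_rV m]_x h (x, y) =
             \int[lebesgue_rV m]_y \int[lebesgue_rV m]_x h' (x, y))%E.
  apply: eq_integral => y _.
  rewrite -[RHS](@ge0_integral_translate_rV _ _ (y *m O)).
  - apply: eq_integral => x _; rewrite /h /h' /=.
    by rewrite opprD addrCA subrr addr0 fN addrC.
  - apply: emeasurable_funM; last exact: mg.
    apply: (measurableT_comp mf); apply: measurable_funD_rV.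
      exact: (@measurable_cst _ _ _ _ _ (y *m O)).
    exact: mN.
  - by move=> x; exact: h'0.
pose A := (\int[lebesgue_rV m]_x f x)%E.
have L : (\int[lebesgue_rV m]_x \int[lebesgue_rV m]_y h (x, y) =
    A * \int[lebesgue_rV m]_y g (y *m O)%R)%E.
  transitivity (\int[lebesgue_rV m]_x
      ((\int[lebesgue_rV m]_y g (y *m O)%R) * f x))%E.
    apply: eq_integral => x _.
    have mgx : measurable_fun setT (fun y : 'rV[R]_m => g (y *m O + x)).
      apply: (measurableT_comp mg).
      by apply: measurable_funD_rV; [exact: mO|exact: measurable_cst].
    apply: etrans; first exact:
      (@ge0_integralZl _ _ _ (lebesgue_rV m) _ measurableT _ mgx _ (fun y _ => g0 _) (f0 x)).
    by apply: (etrans (muleC _ _)); congr (mule _ (f x)); exact: (trans g x mg g0).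
  have G0 : (0 <= \int[lebesgue_rV m]_y g (y *m O)%R)%E.
    by apply: integral_ge0 => y _; exact: g0.
  apply: (etrans _ (muleC _ _)).
  exact: (ge0_integralZl (lebesgue_rV m) measurableT mf (fun y _ => f0 y) G0).
have L' : (\int[lebesgue_rV m]_x \int[lebesgue_rV m]_y h' (x, y) =
    A * \int[lebesgue_rV m]_x g x)%E.
  transitivity (\int[lebesgue_rV m]_x (A * g x))%E.
    apply: eq_integral => x _.
    transitivity (\int[lebesgue_rV m]_y (g x * f (y *m O - x)%R))%E.
      by apply: eq_integral => y _; rewrite muleC.
    have mfx : measurable_fun setT (fun y : 'rV[R]_m => f (y *m O - x)).
      apply: (measurableT_comp mf).
      by apply: measurable_funD_rV; [exact: mO|exact: measurable_cst].
    apply: etrans; first exact: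
      (@ge0_integralZl _ _ _ (lebesgue_rV m) _ measurableT _ mfx _ (fun y _ => f0 _) (g0 x)).
    rewrite muleC; congr (_ * _)%E; apply: (etrans (trans f (- x) mf f0)).
    by apply: eq_integral => y _; exact: fO.
  have A0 : (0 <= A)%E by exact: ltW fgt0.
  exact: (ge0_integralZl (lebesgue_rV m) measurableT mg (fun y _ => g0 y) A0).
apply: (mule_posI fgt0 foo).
exact: (etrans (esym L) (etrans E1 (etrans swap (etrans (esym E2) L')))).
Qed.

(** * Polar coordinates *)

Lemma ge0_integral_mrestr d (T : measurableType d) (R : realType)
    (mu : {measure set T -> \bar R}) (D E : set T) (mD : measurable D)
    (f : T -> \bar R) : measurable E -> measurable_fun E f ->
  (forall x, E x -> 0 <= f x)%E ->
  (\int[mrestr mu mD]_(x in E) f x = \int[mu]_(x in E `&` D) f x)%E.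
Proof.
move=> mE mf f0.
have mED : measurable (E `&` D) by exact: measurableI.
have mEC : measurable (E `&` ~` D) by apply: measurableI => //; exact: measurableC.
have EE : E = (E `&` D) `|` (E `&` ~` D) by rewrite -setIUr setUCr setIT.
rewrite [in LHS]EE ge0_integral_setU//; last 3 first.
- by rewrite -EE.
- by move=> x [] [/f0].
- apply/disj_setPS => x [[_ Dx] [_]]; exact.
rewrite (eq_measure_integral mu); last first.
  by move=> A mA AE; congr (mu _); apply: setIidl => x /AE[].
rewrite [X in (_ + X)%E](eq_measure_integral mzero); last first.
  move=> A mA AE; rewrite -[RHS](measure0 mu); congr (mu _).
  by rewrite -subset0 => x [/AE[_]].
by rewrite integral_measure_zero adde0.
Qed.

Section inverse_power.
Context {R : realType}.

(** The antiderivative is -r^-m. This integral normalizes the weight that polar coordinates put on a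
    ray. *)
Lemma integral_inv_power m (a : R) : (0 < m)%N -> 0 < a ->
  (\int[lebesgue_measure]_(r in `[a, +oo[) (m%:R * (r^-1 ^+ m.+1))%:E =
   (a^-1 ^+ m)%:E)%E.
Proof.
case: m => // m _ a0.
pose F (r : R) := - (r^-1 ^+ m.+1).
have dF (x : R) : 0 < x -> is_derive x 1 F (m.+1%:R * (x^-1 ^+ m.+2)).
  move=> x0; rewrite /F.
  have dV : is_derive x 1 (fun r : R => r^-1) (- x ^- 2 *: 1).
    by apply: is_deriveV; rewrite gt_eqF.
  have := is_deriveN (is_deriveX m.+1 dV).
  rewrite (_ : (fun r : R => - r^-1 ^+ m.+1) = - ((fun r : R => r^-1) ^+ m.+1)).
    move=> /is_derive_eq; apply; rewrite -exprVn /GRing.scale/=.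
    by rewrite !exprS/=; ring.
  by apply/funext => r; rewrite /= exprfctE.
transitivity (0%:E - (F a)%:E)%E; last by rewrite /F -EFinD opprK add0r.
apply: ge0_continuous_FTC2y.
- by move=> x ax; rewrite mulr_ge0// exprn_ge0// invr_ge0 (le_trans (ltW a0)).
- apply: continuous_in_subspaceT => x /set_mem/=; rewrite in_itv/= andbT => ax.
  have x0 : x != 0 by rewrite gt_eqF// (lt_le_trans a0).
  apply: cvgM; first exact: cvg_cst.
  apply: (@continuous_comp _ _ _ (fun r : R => r^-1) (fun r : R => r ^+ m.+2)).
    exact: inv_continuous.
  exact: exprn_continuous.
- rewrite /F -oppr0; apply: cvgN.
  have V0 : (r : R)^-1 @[r --> +oo%R] --> (0 : R).
    apply/gtr0_cvgV0; first by near=> r; near: r; exact: nbhs_pinfty_gt.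
    exact: cvg_id.
  have := continuous_cvg _ (@exprn_continuous R m.+1 0) V0.
  by rewrite expr0n /=; apply; exact: _.
- move=> x ax; have := dF x (lt_trans a0 ax); by case.
- apply: cvg_at_right_filter.
  by have := dF a a0 => /@ex_derive/derivable1_diffP/differentiable_continuous.
- move=> x; rewrite in_itv/= andbT => ax.
  by have := dF x (lt_trans a0 ax) => -[_ <-]; rewrite derive1E.
Unshelve. all: by end_near. Qed.

End inverse_power.

Section polar.
Context {R : realType}.
Local Notation mu := (@lebesgue_measure R).
Local Notation leb := (@lebesgue_rV R).

(** The indicator is part of the weight so that ray integrals run over the whole line, where Tonelli
    and affine substitutions apply directly. *)
Definition ray_weight j (r : R) : R := \1_(`]0, +oo[%classic) r * r ^+ j.

Lemma ray_weight_ge0 j r : 0 <= ray_weight j r.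
Proof.
rewrite /ray_weight indicE; have [|_] := boolP (r \in _); last by rewrite mul0r.
by move=> /set_mem/=; rewrite in_itv/= andbT mul1r => r0; rewrite exprn_ge0// ltW.
Qed.

Lemma ray_weight_le0 j r : r <= 0 -> ray_weight j r = 0.
Proof.
move=> r0; rewrite /ray_weight indicE memNset ?mul0r//= in_itv/= andbT.
by apply/negP; rewrite -leNgt.
Qed.

Lemma ray_weight_gt0 j r : 0 < r -> ray_weight j r = r ^+ j.
Proof.
by move=> r0; rewrite /ray_weight indicE mem_set ?mul1r//= in_itv/= andbT.
Qed.

Lemma ray_weightZ j c r : 0 < c -> c^-1 ^+ j * ray_weight j (c * r) = ray_weight j r.
Proof.
move=> c0; have [r0|r0] := leP r 0.
  by rewrite !ray_weight_le0 ?mulr0// pmulr_rle0.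
rewrite !ray_weight_gt0 ?mulr_gt0// exprMn mulrA -exprMn mulVf ?gt_eqF//.
by rewrite expr1n mul1r.
Qed.

Lemma measurable_ray_weight j : measurable_fun setT (ray_weight j).
Proof. by apply: measurable_funM => //; exact: measurable_indic. Qed.

Definition ray_integral n j (F : 'rV[R]_n -> \bar R) (x : 'rV[R]_n) : \bar R :=
  (\int[mu]_r ((ray_weight j r)%:E * F (r *: x)%R))%E.

Lemma measurable_scale_rV d (T : measurableType d) n (a : T -> R) (x : T -> 'rV[R]_n) :
  measurable_fun setT a -> measurable_fun setT x ->
  measurable_fun setT (fun t => a t *: x t).
Proof.
move=> ma mx; apply: measurable_fun_rV => i; under eq_fun do rewrite mxE.
apply: measurable_funM; first exact: ma.
exact: (measurableT_comp (measurable_rV_coord i) mx).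
Qed.

Lemma measurable_ray n (F : 'rV[R]_n -> \bar R) (x : 'rV[R]_n) :
  measurable_fun setT F ->
  measurable_fun setT (fun r : measurableTypeR R => F (r *: x)).
Proof.
move=> mF; apply: (measurableT_comp mF); apply: measurable_scale_rV.
  exact: measurable_id.
exact: measurable_cst.
Qed.

Section ray_integral.
Variables (n j : nat) (F : 'rV[R]_n -> \bar R).
Hypotheses (mF : measurable_fun setT F) (F0 : forall x, (0 <= F x)%E).

Lemma ray_integrand_ge0 r x : (0 <= (ray_weight j r)%:E * F (r *: x)%R)%E.
Proof. by apply: mule_ge0; [rewrite lee_fin ray_weight_ge0|exact: F0]. Qed.

Lemma measurable_ray_integrand :
  measurable_fun setT (fun p : measurableTypeR R * 'rV[R]_n =>
    ((ray_weight j p.1)%:E * F (p.1 *: p.2)%R)%E).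
Proof.
have m1 : measurable_fun setT (fst : measurableTypeR R * 'rV[R]_n -> _).
  exact: measurable_fst.
have m2 : measurable_fun setT (snd : measurableTypeR R * 'rV[R]_n -> _).
  exact: measurable_snd.
apply: emeasurable_funM.
  apply/measurable_EFinP.
  exact: (measurableT_comp (measurable_ray_weight j) m1).
apply: (measurableT_comp mF); exact: (measurable_scale_rV m1 m2).
Qed.

Lemma measurable_ray_integrand_r x :
  measurable_fun setT (fun r : measurableTypeR R =>
    ((ray_weight j r)%:E * F (r *: x)%R)%E).
Proof.
apply: emeasurable_funM; last exact: measurable_ray.
by apply/measurable_EFinP; exact: (measurable_ray_weight j).
Qed.

Lemma ray_integral_ge0 x : (0 <= ray_integral j F x)%E.
Proof. by apply: integral_ge0 => r _; exact: ray_integrand_ge0. Qed.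

Lemma measurable_ray_integral : measurable_fun setT (ray_integral j F).
Proof.
exact: (@measurable_fun_fubini_tonelli_G _ _ (measurableTypeR R) 'rV[R]_n R
  mu _ measurable_ray_integrand (fun p => ray_integrand_ge0 p.1 p.2)).
Qed.

(** Homogeneity of degree -(j+1), from the substitution s = c r. For j = m - 1 it says that passing
    from x to x/|x| multiplies the ray integral by |x|^m. *)
Lemma ray_integralZ c x : 0 < c ->
  ray_integral j F (c *: x) = ((c^-1 ^+ j.+1)%:E * ray_integral j F x)%E.
Proof.
move=> c0.
pose G (s : R) : \bar R := ((ray_weight j s)%:E * F (s *: x)%R)%E.
have mG : measurable_fun setT (G : measurableTypeR R -> \bar R).
  exact: measurable_ray_integrand_r.
have G0 s : (0 <= G s)%E by exact: ray_integrand_ge0.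
transitivity (\int[mu]_r ((c^-1 ^+ j)%:E * G (c * r + 0)%R))%E.
  apply: eq_integral => r _; rewrite /G addr0 muleA -EFinM ray_weightZ//.
  by rewrite scalerA (mulrC r).
have maff : measurable_fun setT (fun r : R => c * r + 0 : measurableTypeR R).
  by apply: measurable_funD => //; exact: measurable_funM.
have mGc : measurable_fun setT (fun r : measurableTypeR R => G (c * r + 0)).
  exact: (measurableT_comp mG maff).
have cj : (0 <= (c^-1 ^+ j)%:E)%E by rewrite lee_fin exprn_ge0// invr_ge0 ltW.
apply: (etrans (ge0_integralZl mu measurableT mGc (fun r _ => G0 _) cj)).
by rewrite (ge0_integral_affine 0 c0 mG G0) muleA -EFinM exprSr.
Qed.

End ray_integral.

End polar.

Section polar_coordinates.
Context {R : realType}.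
Local Notation mu := (@lebesgue_measure R).
Local Notation leb := (@lebesgue_rV R).

Definition punctured_ball m : set 'rV[R]_m := euclidean_ball m `\` [set 0].
Arguments punctured_ball m _ : clear implicits.

Lemma closed_set0_rV m : closed [set 0 : 'rV[R]_m].
Proof.
rewrite (_ : [set 0] = @enorm R m @^-1` [set 0]).
  apply: closed_comp => [x _|]; first exact: enorm_continuous.
  by apply: accessible_closed_set1; exact/hausdorff_accessible/Rhausdorff.
by apply/seteqP; split => x /= => [->|/eqP]; rewrite ?enorm0// enorm_eq0 => /eqP.
Qed.

Lemma measurable_punctured_ball m : measurable (punctured_ball m).
Proof.
apply: measurableD; first exact: measurable_euclidean_ball.
by apply: closed_measurable_rV; exact: closed_set0_rV.
Qed.

Lemma closed_sphere m : closed (sphere m : set 'rV[R]_m).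
Proof.
rewrite (_ : sphere m = @enorm R m @^-1` [set 1])//.
apply: closed_comp => [x _|]; first exact: enorm_continuous.
by apply: accessible_closed_set1; exact/hausdorff_accessible/Rhausdorff.
Qed.

Lemma sphere_normalize m (x : 'rV[R]_m) : x != 0 -> sphere m (normalize x).
Proof.
move=> x0; rewrite /sphere/= /normalize enormZ ?invr_ge0 ?enorm_ge0//.
by rewrite mulVf// enorm_eq0.
Qed.

(** [normalize] sends 0 to 0, which is off the sphere; this is how the origin drops out of the
    cone. *)
Lemma normalize_sphere_ball m :
  @normalize R m @^-1` sphere m `&` euclidean_ball m = punctured_ball m.
Proof.
apply/seteqP; split => x /= [].
  move=> s b; split => // x0; move: s.
  rewrite /sphere/= /normalize x0 scaler0 enorm0 => /eqP.
  by rewrite eq_sym oner_eq0.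
by move=> b /eqP x0; split => //; exact: sphere_normalize.
Qed.

Lemma ge0_integral_image_measure d d' (T : measurableType d)
    (T' : measurableType d') (nu : {measure set T -> \bar R})
    (phi : {mfun T >-> T'}) (D : set T') (f : T' -> \bar R) :
  measurable D -> measurable_fun D f -> (forall x, D x -> 0 <= f x)%E ->
  (\int[image_measure nu phi]_(y in D) f y =
   \int[nu]_(x in phi @^-1` D) f (phi x))%E.
Proof.
move=> mD mf f0.
have mphi : measurable_fun setT phi by exact: measurable_funPT.
transitivity (\int[pushforward nu phi]_(y in D) f y)%E.
  by apply: eq_measure_integral.
by rewrite ge0_integral_pushforward// => x /set_mem; exact: f0.
Qed.

Lemma ge0_integral_sphere m (h : 'rV[R]_m -> \bar R) :
  measurable_fun setT h -> (forall x, 0 <= h x)%E ->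
  (\int[sphere_measure m]_(x in sphere m) h x =
   m%:R%:E * \int[leb m]_x ((\1_(punctured_ball m) x)%:E * h (normalize x)))%E.
Proof.
move=> mh h0.
have mS : measurable (sphere m : set 'rV[R]_m).
  by apply: closed_measurable_rV; exact: closed_sphere.
have mhS : measurable_fun (sphere m) h by exact: measurable_funTS.
have mhn : measurable_fun setT (h \o @normalize R m).
  exact: (measurableT_comp mh (@measurable_normalize R m)).
have mB := @measurable_euclidean_ball R m.
apply: etrans.
  apply: (ge0_integral_mscale (image_measure (mrestr (leb m) mB) (@normalize R m)) mS
    (m%:R%:nng) mhS); move=> x _; exact: h0.
congr (_ * _)%E.
apply: etrans.
  apply: (ge0_integral_image_measure (mrestr (leb m) mB) (@normalize R m) mS mhS).
  by move=> x _; exact: h0.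
have mSn : measurable (@normalize R m @^-1` sphere m).
  rewrite -[X in measurable X]setTI.
  exact: (@measurable_normalize R m measurableT _ mS).
apply: etrans.
  apply: (ge0_integral_mrestr (leb m) mB mSn).
    by apply: measurable_funTS; exact: mhn.
  by move=> x _; exact: h0.
rewrite normalize_sphere_ball integral_mkcond.
apply: eq_integral => x _; rewrite patchE indicE.
by case: ifPn; rewrite ?mul1e ?mul0e.
Qed.

End polar_coordinates.
Arguments punctured_ball {R} m _.

Section polar_formula.
Context {R : realType}.
Local Notation mu := (@lebesgue_measure R).
Local Notation leb := (@lebesgue_rV R).

(** The power |x|^m is the factor by which a ray integral changes between x and its direction. *)
Let cone_weight m (x : 'rV[R]_m) : R := \1_(punctured_ball m) x * enorm x ^+ m.

Let cone_weight_ge0 m (x : 'rV[R]_m) : 0 <= cone_weight x.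
Proof. by rewrite mulr_ge0// exprn_ge0// enorm_ge0. Qed.

Let measurable_cone_weight m : measurable_fun setT (@cone_weight m).
Proof.
apply: measurable_funM.
  by apply: measurable_indic; exact: measurable_punctured_ball.
by apply: measurable_funX; exact: measurable_enorm.
Qed.

(* The power function is used as a measurable version of the inverse. *)
Let dual_weight m (p : measurableTypeR R * 'rV[R]_m) : R :=
  m%:R * ray_weight m.-1 p.1 * (p.1 `^ (-1)) ^+ m *
    cone_weight (p.1 `^ (-1) *: p.2).

Let dual_weight_ge0 m p : 0 <= @dual_weight m p.
Proof.
apply: mulr_ge0; last exact: cone_weight_ge0.
by rewrite mulr_ge0 ?exprn_ge0 ?powR_ge0// mulr_ge0 ?ray_weight_ge0.
Qed.

Let measurable_dual_weight m : measurable_fun setT (@dual_weight m).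
Proof.
have m1 : measurable_fun setT (fst : measurableTypeR R * 'rV[R]_m -> _).
  exact: measurable_fst.
have m2 : measurable_fun setT (snd : measurableTypeR R * 'rV[R]_m -> _).
  exact: measurable_snd.
have mv : measurable_fun setT (fun p : measurableTypeR R * 'rV[R]_m => p.1 `^ (-1)).
  exact: (measurableT_comp (@measurable_powR R (-1)) m1).
apply: measurable_funM; last first.
  apply: (measurableT_comp (@measurable_cone_weight m)).
  exact: (measurable_scale_rV mv m2).
apply: measurable_funM; last exact: measurable_funX.
apply: measurable_funM; first exact: measurable_cst.
exact: (measurableT_comp (measurable_ray_weight m.-1) m1).
Qed.

(** With x = y/r the ball condition |x| <= 1 becomes r >= |y|, and the powers r^(m-1), r^-m and
    |y/r|^m combine into r^-(m+1) |y|^m. *)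
Let dual_weightE m (r : R) (y : 'rV[R]_m) : (0 < m)%N -> y != 0 ->
  dual_weight (r, y) =
  \1_(`[enorm y, +oo[%classic) r * (m%:R * r^-1 ^+ m.+1 * enorm y ^+ m).
Proof.
move=> m0 y0; rewrite /dual_weight/=.
have ny0 : 0 < enorm y by rewrite enorm_gt0.
have [r0|r0] := leP r 0.
  rewrite ray_weight_le0// mulr0 !mul0r indicE memNset ?mul0r//=.
  by rewrite in_itv/= andbT; apply/negP; rewrite -ltNge (le_lt_trans r0).
have ballE : (enorm (r^-1 *: y) <= 1) = (enorm y <= r).
  rewrite enormZ; last by rewrite invr_ge0 ltW.
  by rewrite mulrC ler_pdivrMr// mul1r.
rewrite ray_weight_gt0// (powR_inv1 (ltW r0)) /cone_weight.
have -> : \1_(punctured_ball m) (r^-1 *: y) = \1_(`[enorm y, +oo[%classic) r :> R.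
  rewrite !indicE; congr (_ : bool)%:R; apply/idP/idP => /set_mem h; apply/mem_set; move: h.
    by move=> [+ _]; rewrite /euclidean_ball/= ballE in_itv/= andbT.
  rewrite /= in_itv/= andbT => yr; split.
    by rewrite /euclidean_ball/= ballE.
  by move=> /eqP; rewrite scaler_eq0 invr_eq0 (negbTE y0) orbF gt_eqF.
rewrite enormZ; last by rewrite invr_ge0 ltW.
case: m m0 y y0 ny0 {ballE} => // m _ y y0 ny0 /=.
rewrite exprMn !exprS.
have rr : r ^+ m * r^-1 ^+ m = 1 by rewrite -exprMn divff ?gt_eqF// expr1n.
transitivity (\1_(`[enorm y, +oo[%classic) r * (m.+1%:R * (r^-1 * (r^-1 * r^-1 ^+ m)) *
  (enorm y * enorm y ^+ m)) * (r ^+ m * r^-1 ^+ m)); first by ring.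
by rewrite rr mulr1.
Qed.

Let integral_dual_weight m (y : 'rV[R]_m) : (0 < m)%N -> y != 0 ->
  (\int[mu]_r (dual_weight (r, y))%:E = 1)%E.
Proof.
move=> m0 y0.
have ny0 : 0 < enorm y by rewrite enorm_gt0.
transitivity (\int[mu]_(r in `[enorm y, +oo[)
    ((enorm y ^+ m)%:E * (m%:R * r^-1 ^+ m.+1)%:E))%E.
  rewrite [RHS]integral_mkcond; apply: eq_integral => r _.
  rewrite dual_weightE// patchE indicE; case: ifPn => _; last by rewrite mul0r.
  by rewrite mul1r -EFinM mulrC.
rewrite ge0_integralZl//.
- rewrite integral_inv_power// -EFinM -exprMn mulfV ?gt_eqF//.
  by rewrite expr1n.
- apply/measurable_EFinP.
  apply: (@eq_measurable_fun _ _ _ _ _ (fun r : measurableTypeR R =>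
      m%:R * (r `^ (-1)) ^+ m.+1)) => [r /set_mem/=|].
    rewrite in_itv/= andbT => yr.
    by rewrite powR_inv1// (le_trans (ltW ny0)).
  apply: measurable_funTS; apply: measurable_funM; first exact: measurable_cst.
  apply: measurable_funX; exact: measurable_powR.
- move=> r /=; rewrite in_itv/= andbT => yr; rewrite lee_fin mulr_ge0//.
  by rewrite exprn_ge0// invr_ge0 (le_trans (ltW ny0)).
- by rewrite lee_fin exprn_ge0// ltW.
Qed.

(* With Phi(rx) weighted over the punctured ball, Tonelli and the substitution
   y = rx turn the integral over the ball into one over the rays r >= |y|, of
   total weight 1. *)
Theorem polar_integral m (Phi : 'rV[R]_m -> \bar R) : (0 < m)%N ->
  measurable_fun setT Phi -> (forall x, 0 <= Phi x)%E ->
  (\int[leb m]_x Phi x =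
   \int[sphere_measure m]_(x in sphere m) ray_integral m.-1 Phi x)%E.
Proof.
move=> m0 mPhi Phi0.
have null0 : leb m [set 0 : 'rV[R]_m] = 0%E.
  by case: (m) m0 => // m' _; exact: lebesgue_rV_set0.
pose h0 := ray_integral m.-1 Phi.
have mh0 : measurable_fun setT h0 by exact: measurable_ray_integral.
have h00 x : (0 <= h0 x)%E by exact: ray_integral_ge0.
have m1 : measurable_fun setT (fst : measurableTypeR R * 'rV[R]_m -> _).
  exact: measurable_fst.
have m2 : measurable_fun setT (snd : measurableTypeR R * 'rV[R]_m -> _).
  exact: measurable_snd.
pose w (x : 'rV[R]_m) := m%:R * cone_weight x.
have w0 x : 0 <= w x by apply: mulr_ge0; [exact: ler0n|exact: cone_weight_ge0].
have mw : measurable_fun setT w.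
  by apply: measurable_funM; [exact: measurable_cst|exact: measurable_cone_weight].
pose K (p : measurableTypeR R * 'rV[R]_m) : \bar R :=
  ((w p.2)%:E * ((ray_weight m.-1 p.1)%:E * Phi (p.1 *: p.2)%R))%E.
have K0 p : (0 <= K p)%E.
  by apply: mule_ge0; [rewrite lee_fin|exact: ray_integrand_ge0].
have mK : measurable_fun setT K.
  apply: emeasurable_funM; last exact: measurable_ray_integrand.
  by apply/measurable_EFinP; exact: (measurableT_comp mw m2).
pose K' (p : measurableTypeR R * 'rV[R]_m) : \bar R :=
  ((dual_weight p)%:E * Phi p.2)%E.
have K'0 p : (0 <= K' p)%E.
  by apply: mule_ge0; [rewrite lee_fin; exact: dual_weight_ge0|exact: Phi0].
have mK' : measurable_fun setT K'.
  apply: emeasurable_funM; last exact: (measurableT_comp mPhi m2).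
  by apply/measurable_EFinP; exact: measurable_dual_weight.
have step1 : (\int[sphere_measure m]_(x in sphere m) h0 x =
    \int[leb m]_x \int[mu]_r K (r, x))%E.
  have mB' := @measurable_punctured_ball R m.
  have mhn : measurable_fun setT
      (fun x => ((\1_(punctured_ball m) x)%:E * h0 (normalize x))%E).
    apply: emeasurable_funM.
      by apply/measurable_EFinP; exact: measurable_indic.
    exact: (measurableT_comp mh0 (@measurable_normalize R m)).
  have hn0 x : (0 <= (\1_(punctured_ball m) x)%:E * h0 (normalize x))%E.
    by apply: mule_ge0 => //; rewrite lee_fin.
  have m0' : (0 <= (m%:R : R)%:E)%E by rewrite lee_fin.
  apply: (etrans (ge0_integral_sphere mh0 h00)).
  apply: (etrans (esym (ge0_integralZl (leb m) measurableT mhn (fun x _ => hn0 x) m0'))).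
  apply: eq_integral => x _.
  apply: etrans; last first.
    apply: esym; apply: (@ge0_integralZl _ _ _ mu _ measurableT _
      (measurable_ray_integrand_r m.-1 mPhi x) (w x)%:E).
      by move=> r _; exact: ray_integrand_ge0.
    by rewrite lee_fin.
  rewrite -/(ray_integral m.-1 Phi x) -/(h0 x) /w /cone_weight indicE.
  have [|_] := boolP (x \in _); last by rewrite mul0e mule0 mul0r mulr0 mul0e.
  move=> /set_mem[_ /eqP x0]; rewrite mul1e mul1r.
  rewrite /h0 /normalize ray_integralZ ?invr_gt0 ?enorm_gt0// invrK prednK//.
  by rewrite muleA -EFinM.
have step2 : (\int[leb m]_x \int[mu]_r K (r, x) =
    \int[mu]_r \int[leb m]_x K (r, x))%E.
  exact: (esym (@fubini_tonelli _ _ _ _ R mu (leb m) K mK K0)).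
have step3 : (\int[mu]_r \int[leb m]_x K (r, x) =
    \int[mu]_r \int[leb m]_y K' (r, y))%E.
  apply: eq_integral => r _.
  have [r0|r0] := leP r 0.
    by rewrite !integral0_eq// => x _; rewrite /K /K' /dual_weight/= ray_weight_le0//
      ?mulr0 ?mul0r ?mul0e ?mule0.
  pose F (y : 'rV[R]_m) : \bar R :=
    ((m%:R * ray_weight m.-1 r * cone_weight (r^-1 *: y))%:E * Phi y)%E.
  have F0 y : (0 <= F y)%E.
    apply: mule_ge0 => //; rewrite lee_fin; apply: mulr_ge0 => //.
    by rewrite mulr_ge0 ?ray_weight_ge0.
  have mF : measurable_fun setT F.
    apply: emeasurable_funM; last exact: mPhi.
    apply/measurable_EFinP; apply: measurable_funM; first exact: measurable_cst.
    apply: (measurableT_comp (@measurable_cone_weight m)).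
    exact: (measurable_scale_rV (@measurable_cst _ _ _ _ _ r^-1) (@measurable_id _ _ _)).
  transitivity (\int[leb m]_x F (r *: x + 0)%R)%E.
    apply: eq_integral => x _; rewrite addr0 /F /K/=.
    rewrite scalerA mulVf ?gt_eqF// scale1r muleA -EFinM /w.
    by congr (_%:E * _)%E; ring.
  apply: (etrans (ge0_integral_affine_rV 0 r0 mF F0)).
  have r0' : (0 <= (r^-1 ^+ m)%:E)%E by rewrite lee_fin exprn_ge0// invr_ge0 ltW.
  apply: (etrans (esym (ge0_integralZl (leb m) measurableT mF (fun x _ => F0 x) r0'))).
  apply: eq_integral => y _; rewrite /F /K' /dual_weight/= muleA -EFinM.
  rewrite (powR_inv1 (ltW r0)).
  by congr (_%:E * _)%E; ring.
have step4 : (\int[mu]_r \int[leb m]_y K' (r, y) =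
    \int[leb m]_y \int[mu]_r K' (r, y))%E.
  exact: (@fubini_tonelli _ _ _ _ R mu (leb m) K' mK' K'0).
apply: esym; apply: (etrans step1); apply: (etrans step2).
apply: (etrans step3); apply: (etrans step4).
(* At y = 0 the weight vanishes instead of having total mass 1, so the integrands are compared off
   this null set. *)
apply: ge0_ae_eq_integral => //.
- exact: (@measurable_fun_fubini_tonelli_G _ _ (measurableTypeR R) 'rV[R]_m R
    mu K' mK' K'0).
- by move=> y _; apply: integral_ge0 => r _; exact: K'0.
- exists [set 0]; split.
  + by apply: closed_measurable_rV; exact: closed_set0_rV.
  + exact: null0.
  + move=> y /=; apply: contra_notP => /eqP y0 _.
    have mD : measurable_fun setT (fun r : measurableTypeR R => (dual_weight (r, y))%:E).
      apply/measurable_EFinP.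
      exact: (measurableT_comp (@measurable_dual_weight m) (measurable_pair2 y)).
    transitivity (\int[mu]_r (Phi y * (dual_weight (r, y))%:E))%E.
      by apply: eq_integral => r _; rewrite muleC.
    apply: (etrans (ge0_integralZl mu measurableT mD _ (Phi0 y))).
      by move=> r _; rewrite lee_fin; exact: dual_weight_ge0.
    by rewrite integral_dual_weight// mule1.
Qed.

End polar_formula.

(** * Star bodies and radial functions *)

Section gauge.
Context {R : realType} (n : nat).

(** The properties of the Minkowski functional of a star body on which the analysis rests. Stating
    them for a function N makes dilates of the body available as multiples of N. *)
Definition gauge (N : 'rV[R]_n -> R) :=
  [/\ continuous N, forall c x, 0 <= c -> N (c *: x) = c * N x &
      forall x, x != 0 -> 0 < N x].

(** The largest s in [a, b] with s v in K exists by compactness; points of the ray just beyond it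
    leave K, so it is not interior. *)
Lemma last_boundary_point (K : set 'rV[R]_n) (v : 'rV[R]_n) (a b : R) :
  closed K -> a < b -> K (a *: v) -> ~ K (b *: v) ->
  exists t, [/\ a <= t < b, boundary K (t *: v) &
    forall s, t < s <= b -> ~ K (s *: v)].
Proof.
move=> cK ab Ka Kb.
have cv : continuous (fun s : R => s *: v) by exact: scalel_continuous.
pose S := `[a, b]%classic `&` [set s : R | K (s *: v)].
have cS : compact S.
  apply: compact_closedI; first exact: segment_compact.
  by apply: (@closed_comp _ _ (fun s : R => s *: v)) => // s _; exact: cv.
have S0 : S !=set0 by exists a; split => //=; rewrite in_itv/= lexx ltW.
have [t /set_mem[/= tab Kt] tmax] := @compact_EVT_max _ R idfun S S0 cS
  (continuous_subspaceT (fun x => @cvg_id _ (nbhs x))).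
move: tab; rewrite in_itv/= => /andP[at_ tb].
have tltb : t < b by rewrite lt_neqAle tb andbT; apply/eqP => tb'; rewrite tb' in Kt.
have noK s : t < s <= b -> ~ K (s *: v).
  move=> /andP[ts sb] Ks.
  have : s \in S by apply/mem_set; split => //=; rewrite in_itv/= sb (le_trans at_ (ltW ts)).
  by move=> /tmax; rewrite /= leNgt ts.
exists t; split => //; first by rewrite at_.
split; first exact: subset_closure.
move=> /cv/nbhs_ballP[e /= e0 be].
have ts : t < Num.min (t + e / 2) b by rewrite lt_min tltb andbT; lra.
apply: (noK (Num.min (t + e / 2) b)); first by rewrite ts ge_min lexx orbT.
apply: be; rewrite /ball/= ltr_distlC.
have : Num.min (t + e / 2) b <= t + e / 2 by rewrite ge_min lexx.
by move: ts => /= ts h; apply/andP; split; lra.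
Qed.

Let mink_set (K : set 'rV[R]_n) (x : 'rV[R]_n) : set R :=
  [set a | 0 <= a /\ [set a *: y | y in K] x].

Section star_body_gauge.
Variable K : set 'rV[R]_n.
Hypothesis hK : star_body K.
Local Notation N := (minkowski_functional K).

Let K0 : K 0.
Proof. by have [_ _ _ /interior_subset] := hK. Qed.

Let absorbing v : exists2 e : R, 0 < e & forall s, `|s| < e -> K (s *: v).
Proof.
have [_ _ _ iK0 _] := hK.
have cv : continuous (fun s : R => s *: v) by exact: scalel_continuous.
have : nbhs ((0 : R) *: v) K by rewrite scale0r.
move=> /cv/nbhs_ballP[e /= e0 be]; exists e => // s se.
by apply: be; rewrite /ball/= sub0r normrN.
Qed.

Let bounding : exists2 M : R, 0 < M & forall y, K y -> `|y| <= M.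
Proof.
have [_ [M [_ KM]] _ _ _] := hK.
exists (Num.max 1 (M + 1)); first by rewrite lt_max ltr01.
by move=> y Ky; apply: KM => //; rewrite lt_max ltrDl ltr01 orbT.
Qed.

Let mink_set_neq0 x : mink_set K x !=set0.
Proof.
have [e e0 he] := absorbing x; exists (2 / e); split; first by rewrite divr_ge0// ltW.
exists ((e / 2) *: x); first by apply: he; rewrite gtr0_norm ?divr_gt0// ltr_pdivrMr// ltr_pMr// ltr1n.
by rewrite scalerA mulrA mulfVK ?gt_eqF// divff// scale1r.
Qed.

Let mink_set_lb x : lbound (mink_set K x) 0.
Proof. by move=> a []. Qed.

Let mink_le x a : mink_set K x a -> N x <= a.
Proof. by move=> xa; apply: ge_inf => //; exists 0; exact: mink_set_lb. Qed.

Let mink_ge x b : (forall a, mink_set K x a -> b <= a) -> b <= N x.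
Proof. by move=> xb; apply: lb_le_inf => //; exact: mink_set_neq0. Qed.

Let mink_lt x b : N x < b -> exists2 a, mink_set K x a & a < b.
Proof.
move=> xb; apply: contrapT => h; move: xb; apply/negP; rewrite -leNgt.
by apply: mink_ge => a xa; rewrite leNgt; apply/negP => ab; apply: h; exists a.
Qed.

Lemma minkowski_ge0 x : 0 <= N x.
Proof. exact/mink_ge/mink_set_lb. Qed.

Lemma minkowski_functionalZ c x : 0 <= c -> N (c *: x) = c * N x.
Proof.
have le_scale d y : 0 < d -> N (d *: y) <= d * N y.
  move=> d0; rewrite mulrC -ler_pdivrMr//; apply: mink_ge => a [a0 [z Kz <-]].
  rewrite ler_pdivrMr// mulrC; apply: mink_le; split; first by rewrite mulr_ge0// ltW.
  by exists z => //; rewrite scalerA.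
rewrite le_eqVlt => /predU1P[<-|c0].
  rewrite mul0r scale0r; apply/eqP; rewrite eq_le minkowski_ge0 andbT.
  by apply: mink_le; split => //; exists 0 => //; rewrite scale0r.
apply/eqP; rewrite eq_le le_scale//=.
rewrite mulrC -ler_pdivlMr// mulrC.
by apply: le_trans (le_scale c^-1 (c *: x) _); rewrite ?invr_gt0// scalerA mulVf ?gt_eqF// scale1r.
Qed.

Lemma minkowski_functional_gt0 x : x != 0 -> 0 < N x.
Proof.
move=> x0; have [M M0 KM] := bounding.
apply: (@lt_le_trans _ _ (`|x| / M)); first by rewrite divr_gt0// normr_gt0.
apply: mink_ge => a [a0 [y Ky <-]].
by rewrite normrZ (ger0_norm a0) ler_pdivrMr// ler_wpM2l// KM.
Qed.

Let unbounded v s : v != 0 -> exists2 b, s < b & ~ K (b *: v).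
Proof.
move=> v0; have [M M0 KM] := bounding.
have nv : 0 < `|v| by rewrite normr_gt0.
exists (Num.max s (M / `|v|) + 1); first by rewrite ltr_pwDr// le_max lexx.
move=> /KM; apply/negP; rewrite -ltNge normrZ -ltr_pdivrMr//.
apply: lt_le_trans (ler_norm _).
by rewrite ltr_pwDr// le_max lexx orbT.
Qed.

(* A point outside K with N <= 1 would yield two boundary points on its ray,
   hence three on its line. *)
Lemma star_bodyE x : K x <-> N x <= 1.
Proof.
have [cK _ line iK0 _] := hK.
split=> [Kx|Nx]; first by apply: mink_le; split => //; exists x => //; rewrite scale1r.
apply: contrapT => nKx.
have x0 : x != 0 by apply: contra_notN nKx => /eqP ->.
have bnd0 t v : boundary K (t *: v) -> t != 0.
  by move=> [_]; apply: contra_notN => /eqP ->; rewrite scale0r.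
have K0v v : K (0 *: v) by rewrite scale0r.
have nK1 : ~ K (1 *: x) by rewrite scale1r.
have [t1 [/andP[t1ge t1lt] B1 max1]] := last_boundary_point cK ltr01 (K0v x) nK1.
have t10 : 0 < t1 by rewrite lt_neqAle eq_sym t1ge (bnd0 _ _ B1).
(* As N x <= 1 < 1/t1, some a < 1/t1 has x in a K. Then a^-1 x is a point of K beyond t1, and by
   maximality of t1 even beyond 1, so the ray leaves K and comes back. *)
have [a [a0 [y Ky yx]] at1] : exists2 a, mink_set K x a & a < t1^-1.
  by apply: mink_lt; rewrite (le_lt_trans Nx)// invf_gt1.
have a0' : 0 < a.
  rewrite lt_neqAle a0 andbT; apply: contra_neq x0 => a00.
  by rewrite -yx -a00 scale0r.
have Ka : K (a^-1 *: x) by rewrite -yx scalerA mulVf ?gt_eqF// scale1r.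
have ta : t1 < a^-1 by rewrite -[t1]invrK ltf_pV2 ?posrE ?invr_gt0.
have a1 : 1 < a^-1.
  by rewrite ltNge; apply/negP => a1; apply: (max1 a^-1) => //; rewrite ta.
(* Boundedness of K forces a second exit t2 >= a^-1 on this ray and an exit t3 on the opposite one.
   The parameters t1, t2 and -t3 are distinct, one too many for the line. *)
have [b ab nKb] := unbounded a^-1 x0.
have [t2 [/andP[t2ge _] B2 _]] := last_boundary_point cK ab Ka nKb.
have nx0 : - x != 0 by rewrite oppr_eq0.
have [b' b0' nKb'] := unbounded 0 nx0.
have [t3 [/andP[t3ge _] B3 _]] := last_boundary_point cK b0' (K0v (- x)) nKb'.
have t30 : 0 < t3 by rewrite lt_neqAle eq_sym t3ge (bnd0 _ _ B3).
have [p [q [_ pq]]] := line x x0.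
have inpq t : boundary K (t *: x) -> t != 0 -> [set p; q] (t *: x).
  move=> Bt t0; rewrite -pq; split; first by split => //; exists t.
  by move=> /= /eqP; rewrite scaler_eq0 (negbTE t0) (negbTE x0).
have inj s t : s *: x = t *: x -> s = t.
  by move=> /eqP; rewrite -subr_eq0 -scalerBl scaler_eq0 (negbTE x0) orbF subr_eq0 => /eqP.
have B3' : boundary K (- t3 *: x) by rewrite scaleNr -scalerN.
have h1 := inpq t1 B1 (bnd0 _ _ B1).
have h2 := inpq t2 B2 (bnd0 _ _ B2).
have h3 := inpq (- t3) B3' (bnd0 _ _ B3').
have t12 : t1 <> t2 by move=> t12; move: t2ge; rewrite -t12 leNgt ta.
have t13 : t1 <> - t3 by lra.
have t23 : t2 <> - t3 by lra.
case: h1 => /= e1; case: h2 => /= e2; case: h3 => /= e3.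
- by apply: t12; apply: inj; rewrite e1 e2.
- by apply: t12; apply: inj; rewrite e1 e2.
- by apply: t13; apply: inj; rewrite e1 e3.
- by apply: t23; apply: inj; rewrite e2 e3.
- by apply: t23; apply: inj; rewrite e2 e3.
- by apply: t13; apply: inj; rewrite e1 e3.
- by apply: t12; apply: inj; rewrite e1 e2.
- by apply: t12; apply: inj; rewrite e1 e2.
Qed.

Lemma star_body_gauge : gauge N.
Proof.
have [_ _ _ _ cN] := hK; split => //.
  exact: minkowski_functionalZ.
exact: minkowski_functional_gt0.
Qed.

End star_body_gauge.
End gauge.

(** * Integrals depending continuously on a parameter *)

Section parametric_integral.
Context {R : realType}.

(** A tube argument: near (x0, s) both g x s' and g x0 s' are within e/2 of g x0 s, and finitely
    many such neighbourhoods cover D. Joint continuity enters only at the points of {x0} x D. *)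
Lemma near_uniform_compact (X S : topologicalType) (D : set S)
    (g : X -> S -> R) (x0 : X) (e : R) :
  compact D ->
  (forall s, D s -> {for (x0, s), continuous (fun p : X * S => g p.1 p.2)}) ->
  0 < e ->
  \forall x \near x0, forall s, D s -> `|g x0 s - g x s| < e.
Proof.
move=> /compact_near_coveringP cD cg e0.
apply: (cD X (nbhs x0) (fun x s => `|g x0 s - g x s| < e)) => s Ds.
have e2 : 0 < e / 2 by rewrite divr_gt0.
have /cvgrPdist_lt/(_ _ e2) := cg s Ds.
case=> -[/= A B] [nA nB] AB; exists (B, A) => //= -[s' x] [/= Bs' Ax].
have h1 := AB (x, s') (conj Ax Bs').
have h2 := AB (x0, s') (conj (nbhs_singleton nA) Bs').
move: h1 h2 => /= h1 h2.
rewrite (le_lt_trans (ler_distD (g x0 s) _ _))//.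
by rewrite [X in X + _]distrC (splitr e) ltrD.
Qed.

Lemma compact_bounded_above (S : topologicalType) (D : set S) (f : S -> R) :
  compact D -> (forall s, D s -> {for s, continuous f}) ->
  exists2 M, 0 <= M & forall s, D s -> f s <= M.
Proof.
move=> cD cf; have [->|/set0P D0] := eqVneq D set0; first by exists 0.
have cfD : {within D, continuous f}.
  by apply: continuous_in_subspaceT => s /set_mem; exact: cf.
have [c _ fc] := compact_EVT_max D0 cD cfD.
exists (Num.max 0 (f c)); first by rewrite le_max lexx.
by move=> s /mem_set/fc fs; rewrite le_max fs orbT.
Qed.

Context d (S : measurableType d) (mu : {measure set S -> \bar R}).
Variable D : set S.
Hypotheses (mD : measurable D) (Doo : (mu D < +oo)%E).

Lemma ge0_integral_bounded_fin_num (f : S -> R) (M : R) :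
  measurable_fun D f -> (forall s, D s -> 0 <= f s <= M) ->
  (\int[mu]_(s in D) (f s)%:E)%E \is a fin_num.
Proof.
move=> mf fM; rewrite ge0_fin_numE; last first.
  by apply: integral_ge0 => s /fM /andP[f0 _]; rewrite lee_fin.
apply: (@le_lt_trans _ _ (\int[mu]_(s in D) (Num.max 0 M)%:E)%E).
  apply: ge0_le_integral => //.
  - by move=> s /fM /andP[f0 _]; rewrite lee_fin.
  - exact/measurable_EFinP.
  - by move=> s /fM /andP[_ h]; rewrite lee_fin le_max h orbT.
rewrite integral_cst// lte_mul_pinfty//; first by rewrite lee_fin le_max lexx.
Qed.

Lemma fine_integral_le_add (f g : S -> R) (e M : R) :
  measurable_fun D f -> measurable_fun D g -> 0 <= e ->
  (forall s, D s -> 0 <= f s <= M) -> (forall s, D s -> 0 <= g s <= M) ->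
  (forall s, D s -> f s <= g s + e) ->
  fine (\int[mu]_(s in D) (f s)%:E)%E <=
  fine (\int[mu]_(s in D) (g s)%:E)%E + e * fine (mu D).
Proof.
move=> mf mg e0 fM gM fge.
have If := ge0_integral_bounded_fin_num mf fM.
have Ig := ge0_integral_bounded_fin_num mg gM.
have fD : mu D \is a fin_num by rewrite ge0_fin_numE.
rewrite -lee_fin EFinD EFinM !fineK//.
rewrite -integral_cst// -ge0_integralD//.
- apply: ge0_le_integral => //.
  + by move=> s /fM /andP[f0 _]; rewrite lee_fin.
  + exact/measurable_EFinP.
  + by apply: emeasurable_funD => //; exact/measurable_EFinP.
- by move=> s /gM /andP[g0 _]; rewrite lee_fin.
- exact/measurable_EFinP.
Qed.

(** On a set of finite measure uniform closeness bounds the difference of integrals. A bound at x0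
    suffices, since nearby functions exceed it by at most c. *)
Lemma cvg_integral_uniform (X : topologicalType) (x0 : X) (g : X -> S -> R) (M : R) :
  (forall x, measurable_fun D (g x)) -> (forall x s, D s -> 0 <= g x s) ->
  (forall s, D s -> g x0 s <= M) ->
  (forall e, 0 < e -> \forall x \near x0, forall s, D s -> `|g x0 s - g x s| < e) ->
  (fun x => fine (\int[mu]_(s in D) (g x s)%:E)%E) x @[x --> x0] -->
  fine (\int[mu]_(s in D) (g x0 s)%:E)%E.
Proof.
move=> mg g0 gM gu; apply/cvgrPdist_le => e e0.
have mu0 : 0 <= fine (mu D) by rewrite fine_ge0.
(* The summand 1 keeps the denominator positive when D is null. *)
pose c := e / (fine (mu D) + 1).
have c0 : 0 < c by rewrite divr_gt0// ltr_pwDr.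
near=> x.
have xu : forall s, D s -> `|g x0 s - g x s| < c by near: x; exact: gu.
have B0 s : D s -> 0 <= g x0 s <= M + c.
  by move=> Ds; rewrite g0//= (le_trans (gM _ Ds))// lerDl ltW.
have B1 s : D s -> 0 <= g x s <= M + c.
  move=> Ds; rewrite g0//=; have := xu s Ds; rewrite ltr_distlC => /andP[_ h].
  by rewrite (le_trans (ltW h))// lerD2r gM.
have cD : c * fine (mu D) <= e.
  rewrite /c mulrAC ler_pdivrMr ?ltr_pwDr//.
  by apply: ler_wpM2l; [exact: ltW|rewrite lerDl].
have h1 := @fine_integral_le_add (g x0) (g x) c (M + c) (mg _) (mg _) (ltW c0) B0 B1.
have h2 := @fine_integral_le_add (g x) (g x0) c (M + c) (mg _) (mg _) (ltW c0) B1 B0.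
have {}h1 := h1 _; have {}h2 := h2 _.
rewrite ler_distl; apply/andP; split.
  rewrite lerBlDr; apply: le_trans (h2 _) _; last by rewrite lerD2l.
  by move=> s /xu; rewrite ltr_distlC => /andP[_ /ltW].
apply: le_trans (h1 _) _; last by rewrite lerD2l.
by move=> s /xu; rewrite ltr_distlC => /andP[/ltW]; rewrite lerBlDr.
Unshelve. all: by end_near.
Qed.

End parametric_integral.

Lemma cvg_rV (R : realType) n T (F : set_system T) (FF : Filter F)
    (f : T -> 'rV[R]_n) (l : 'rV[R]_n) :
  (forall i, f x ord0 i @[x --> F] --> l ord0 i) -> f x @[x --> F] --> l.
Proof.
move=> fl; apply/cvg_ballP => e e0.
have : \forall x \near F, forall i, `|l ord0 i - f x ord0 i| < e.
  by apply: filter_forall => i; move/cvgrPdist_lt : (fl i); apply.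
by apply: filterS => x h; split => // i j; rewrite ord1; exact: h.
Qed.

(** * Radial functions as continuous functions *)

Section radial_function.
Context {R : realType} (n : nat).
Local Notation mu := (@lebesgue_measure R).
Local Notation leb := (@lebesgue_rV R).
Implicit Types (N f : 'rV[R]_n -> R) (x u : 'rV[R]_n).

Definition body_fun N f x : R := if N x <= 1 then f x else 0.

Definition segment_integral j f u : R :=
  fine (\int[mu]_(s in `]0%R, 1%R]) (s ^+ j * f (s *: u))%:E)%E.

(** The function h_F of the overview for j = m - 1, after the substitution r = s / N x. The cutoff
    at N <= 1 has become the fixed upper limit 1, so no discontinuity is left apart from the
    origin. *)
Definition radial_fun N f j x : R :=
  (N x)^-1 ^+ j.+1 * segment_integral j f ((N x)^-1 *: x).

Lemma continuous_scale_rV (p : 'rV[R]_n * R) :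
  {for p, continuous (fun p : 'rV[R]_n * R => p.2 *: p.1)}.
Proof.
by apply: (@continuousZ _ _ _ snd fst); [exact: cvg_snd|exact: cvg_fst].
Qed.

Section segment.
Variables (j : nat) (f : 'rV[R]_n -> R).
Hypotheses (cf : continuous f) (f0 : forall x, 0 <= f x).

Let g u (s : R) : R := s ^+ j * f (s *: u).

Let cg (p : 'rV[R]_n * R) : {for p, continuous (fun p => g p.1 p.2)}.
Proof.
apply: (@continuousM R _ (fun p : 'rV[R]_n * R => p.2 ^+ j)
  (fun p : 'rV[R]_n * R => f (p.2 *: p.1))).
  apply: (@continuous_comp _ _ _ (@snd 'rV[R]_n R) (fun r : R => r ^+ j)).
    exact: cvg_snd.
  exact: exprn_continuous.
apply: (@continuous_comp _ _ _ (fun p : 'rV[R]_n * R => p.2 *: p.1) f).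
  exact: continuous_scale_rV.
exact: cf.
Qed.

Let cgs u : continuous (g u).
Proof.
move=> s; apply: (@continuousM R _ (fun s : R => s ^+ j) (fun s : R => f (s *: u))).
  exact: exprn_continuous.
apply: (@continuous_comp _ _ _ (fun s : R => s *: u) f); last exact: cf.
exact: scalel_continuous.
Qed.

Let mD : measurable (`]0, 1]%classic : set (measurableTypeR R)).
Proof. exact: measurable_itv. Qed.

Let Doo : (mu `]0%R, 1%R]%classic < +oo)%E.
Proof. by rewrite lebesgue_measure_itv/= lte_fin ltr01 -EFinD ltry. Qed.

Let D01 (s : R) : `]0, 1]%classic s -> `[0, 1]%classic s.
Proof. by rewrite /= !in_itv/= => /andP[/ltW -> ->]. Qed.

Let mg u : measurable_fun (`]0, 1]%classic : set (measurableTypeR R)) (g u).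
Proof. by apply: measurable_funTS; apply: continuous_measurable_fun; exact: cgs. Qed.

Let g0 u s : `]0, 1]%classic s -> 0 <= g u s.
Proof.
by rewrite /= in_itv/= => /andP[s0 _]; rewrite mulr_ge0// exprn_ge0// ltW.
Qed.

Let gM u : exists2 M, 0 <= M & forall s, `]0, 1]%classic s -> g u s <= M.
Proof.
have [M M0 gM] := @compact_bounded_above R R `[0, 1]%classic (g u)
  (@segment_compact R 0 1) (fun s _ => @cgs u s).
by exists M => // s /D01; exact: gM.
Qed.

Lemma segment_integral_fin_num u :
  (\int[mu]_(s in `]0%R, 1%R]) (s ^+ j * f (s *: u))%:E)%E \is a fin_num.
Proof.
have [M _ guM] := gM u.
apply: (ge0_integral_bounded_fin_num mD Doo (mg u) (M := M)) => s Ds.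
by rewrite g0//= guM.
Qed.

Lemma segment_integral_ge0 u : 0 <= segment_integral j f u.
Proof.
by apply: fine_ge0; apply: integral_ge0 => s Ds; rewrite lee_fin; exact: g0.
Qed.

Lemma segment_integral_continuous : continuous (segment_integral j f).
Proof.
move=> u; have [M _ guM] := gM u.
apply: (cvg_integral_uniform mD Doo (g := g) (M := M)) => // e e0.
have := @near_uniform_compact R _ R `[0, 1]%classic g u e
  (@segment_compact R 0 1) (fun s _ => @cg (u, s)) e0.
by apply: filterS => v h s /D01; exact: h.
Qed.

End segment.

Section radial.
Variables (N f : 'rV[R]_n -> R).
Hypotheses (gN : gauge N) (cf : continuous f) (f0 : forall x, 0 <= f x).

Let cN : continuous N. Proof. by case: gN. Qed.
Let NZ c x : 0 <= c -> N (c *: x) = c * N x. Proof. by case: gN => _ h _; exact: h. Qed.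
Let N_gt0 x : x != 0 -> 0 < N x. Proof. by case: gN => _ _; exact. Qed.

Lemma gauge0 : N 0 = 0.
Proof. by rewrite -(scale0r 0) NZ// mul0r. Qed.

Lemma gauge_ge0 x : 0 <= N x.
Proof. by have [->|/N_gt0/ltW//] := eqVneq x 0; rewrite gauge0. Qed.

Lemma measurable_gauge_le (c : R) : measurable [set x : 'rV[R]_n | N x <= c].
Proof.
apply: closed_measurable_rV.
apply: (@closed_comp _ _ N [set r | r <= c]) => [x _|]; first exact: cN.
exact: closed_le.
Qed.

Lemma body_fun_ge0 x : 0 <= body_fun N f x.
Proof. by rewrite /body_fun; case: ifP. Qed.

Lemma body_funE : body_fun N f = f \_ [set x | N x <= 1].
Proof.
apply/funext => x; rewrite patchE /body_fun; congr (if _ then _ else _).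
by apply/idP/idP => [h|/set_mem//]; exact/mem_set.
Qed.

Lemma measurable_body_fun : measurable_fun setT (body_fun N f).
Proof.
rewrite body_funE; apply/(measurable_restrictT _ (measurable_gauge_le 1)).
by apply: measurable_funTS; exact: continuous_measurable_fun_rV.
Qed.

(** By homogeneity it is enough to treat u = x / N x. Since N u = 1, the cutoff along the ray of u
    reads r <= 1. *)
Lemma ray_integral_body_fun j x : x != 0 ->
  ray_integral j (EFin \o body_fun N f) x = (radial_fun N f j x)%:E.
Proof.
move=> x0; have Nx := N_gt0 x0.
have mF : measurable_fun setT (EFin \o body_fun N f).
  by apply/measurable_EFinP; exact: measurable_body_fun.
have F0 y : (0 <= (EFin \o body_fun N f) y)%E by rewrite lee_fin body_fun_ge0.
pose u := (N x)^-1 *: x.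
have xu : x = N x *: u by rewrite /u scalerA mulfV ?gt_eqF// scale1r.
have Nu : N u = 1 by rewrite NZ ?invr_ge0 ?ltW// mulVf ?gt_eqF.
rewrite {1}xu (ray_integralZ j mF F0 _ Nx) EFinM -/u; congr (_ * _)%E.
rewrite /segment_integral fineK; last exact: segment_integral_fin_num.
rewrite [RHS]integral_mkcond; apply: eq_integral => r _.
rewrite patchE /=; have [r0|r0] := leP r 0.
  rewrite ray_weight_le0// mul0e ifF//; apply/negP => /set_mem/=.
  by rewrite in_itv/= ltNge r0.
rewrite ray_weight_gt0// /body_fun (NZ _ (ltW r0)) Nu mulr1.
have [r1|r1] := leP r 1; last first.
  rewrite mule0 ifF//; apply/negP => /set_mem/=.
  by rewrite in_itv/= r0/= leNgt r1.
by rewrite ifT//; apply/mem_set => /=; rewrite in_itv/= r0.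
Qed.

Lemma radial_fun_ge0 j x : 0 <= radial_fun N f j x.
Proof.
rewrite mulr_ge0 ?exprn_ge0 ?invr_ge0 ?gauge_ge0//.
exact: segment_integral_ge0.
Qed.

Lemma measurable_radial_fun j : measurable_fun setT (radial_fun N f j).
Proof.
rewrite (_ : radial_fun N f j = fun x => (N x `^ (-1)) ^+ j.+1 *
    segment_integral j f (N x `^ (-1) *: x)); last first.
  by apply/funext => x; rewrite powR_inv1// gauge_ge0.
have mV : measurable_fun setT (fun x => N x `^ (-1)).
  apply: (measurableT_comp (@measurable_powR R (-1))).
  exact: continuous_measurable_fun_rV.
apply: measurable_funM; first exact: measurable_funX.
apply: (@measurableT_comp _ _ _ _ _ _ (segment_integral j f)).
  by apply: continuous_measurable_fun_rV; exact: segment_integral_continuous.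
exact: (measurable_scale_rV mV (@measurable_id _ _ _)).
Qed.

Lemma radial_fun_continuous j x : x != 0 -> {for x, continuous (radial_fun N f j)}.
Proof.
move=> x0; have cV : {for x, continuous (fun y => (N y)^-1)}.
  apply: (@continuous_comp _ _ _ N (fun r : R => r^-1)); first exact: cN.
  by apply: inv_continuous; rewrite gt_eqF// N_gt0.
apply: (@continuousM R _ (fun y => (N y)^-1 ^+ j.+1)
  (fun y => segment_integral j f ((N y)^-1 *: y))).
  apply: (@continuous_comp _ _ _ (fun y => (N y)^-1) (fun r : R => r ^+ j.+1)) => //.
  exact: exprn_continuous.
apply: (@continuous_comp _ _ _ (fun y => (N y)^-1 *: y) (segment_integral j f)).
  by apply: (@continuousZ _ _ _ (fun y => (N y)^-1) id) => //; exact: cvg_id.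
exact: segment_integral_continuous.
Qed.

End radial.
End radial_function.

(** * Central sections in polar coordinates *)

Section section_integral.
Context {R : realType}.
Local Notation leb := (@lebesgue_rV R).

Lemma bounded_set_coord n (A : set 'rV[R]_n) (M : R) :
  (forall x i, A x -> `|x ord0 i| <= M) -> bounded_set A.
Proof.
move=> AM; exists (Num.max 0 M); split; first exact: num_real.
move=> M' MM' x Ax; rewrite /Num.norm/= mx_normrE.
apply: bigmax_le => [|[i j] _].
  by rewrite (le_trans _ (ltW MM'))// le_max lexx.
by rewrite !ord1/= (le_trans (AM _ _ Ax))// (le_trans _ (ltW MM'))// le_max lexx orbT.
Qed.

Lemma compact_sphere m : compact (sphere m : set 'rV[R]_m).
Proof.
apply: bounded_closed_compact; last exact: closed_sphere.
apply: (@bounded_set_coord _ _ 1) => x i; rewrite /sphere/= => <-.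
exact: ler_coord_enorm.
Qed.

Lemma measurable_sphere m : measurable (sphere m : set 'rV[R]_m).
Proof. by apply: closed_measurable_rV; exact: closed_sphere. Qed.

Lemma sphere_measure_lty m : (sphere_measure m (sphere m : set 'rV[R]_m) < +oo)%E.
Proof.
have h0 x : (0 <= (cst 1%E : 'rV[R]_m -> \bar R) x)%E by rewrite lee_fin.
have := ge0_integral_sphere (@measurable_cst _ _ _ _ setT 1%E) h0.
rewrite integral_cst; last exact: measurable_sphere.
rewrite mul1e => ->; apply: lte_mul_pinfty; rewrite ?lee_fin//.
under eq_integral do rewrite mule1.
rewrite integral_indicT; last exact: measurable_punctured_ball.
apply: (@lebesgue_rV_bounded _ _ 1); first exact: measurable_punctured_ball.
by move=> x i [b _]; apply: le_trans b; exact: ler_coord_enorm.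
Qed.

Lemma sphere_neq0 m (x : 'rV[R]_m) : sphere m x -> x != 0.
Proof. by rewrite /sphere/= => x1; rewrite -enorm_gt0 x1. Qed.

Lemma isometry_neq0 m n (U : 'M[R]_(m, n)) (y : 'rV[R]_m) :
  U *m U^T = 1%:M -> y != 0 -> y *m U != 0.
Proof. by move=> UU; rewrite -!enorm_gt0 enorm_isometry. Qed.

Variables (m n : nat).
Hypothesis m0 : (0 < m)%N.
Variables (N f : 'rV[R]_n -> R).
Hypotheses (gN : gauge N) (cf : continuous f) (f0 : forall x, 0 <= f x).

Lemma measurable_body_fun_mulmx (U : 'M[R]_(m, n)) :
  measurable_fun setT (fun y : 'rV[R]_m => (body_fun N f (y *m U))%:E).
Proof.
apply/measurable_EFinP.
exact: (measurableT_comp (measurable_body_fun gN cf) (measurable_mulmxr U)).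
Qed.

Lemma integral_body_fun_polar (U : 'M[R]_(m, n)) : U *m U^T = 1%:M ->
  (\int[leb m]_y (body_fun N f (y *m U))%:E =
   \int[sphere_measure m]_(y in sphere m) (radial_fun N f m.-1 (y *m U))%:E)%E.
Proof.
move=> UU.
rewrite (polar_integral m0 (measurable_body_fun_mulmx U)); last first.
  by move=> y; rewrite lee_fin; exact: body_fun_ge0.
apply: eq_integral => y /set_mem/sphere_neq0 y0.
rewrite -(ray_integral_body_fun gN cf f0); last exact: isometry_neq0.
by apply: eq_integral => r _; rewrite /= -scalemxAl.
Qed.

Lemma measurable_radial_fun_mulmx (U : 'M[R]_(m, n)) :
  measurable_fun setT (fun y : 'rV[R]_m => radial_fun N f m.-1 (y *m U)).
Proof.
exact: (measurableT_comp (measurable_radial_fun gN cf f0 m.-1) (measurable_mulmxr U)).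
Qed.

Lemma continuous_mulmx_vec (p : 'rV[R]_(m * n) * 'rV[R]_m) :
  {for p, continuous (fun p : 'rV[R]_(m * n) * 'rV[R]_m => p.2 *m vec_mx p.1)}.
Proof.
apply: cvg_rV => j; rewrite mxE; under eq_fun do rewrite mxE.
apply: (cvg_sumr (nbhs_filter p)) => i; rewrite !mxE.
under eq_fun do rewrite mxE.
apply: cvgM.
  apply: (@continuous_comp _ _ _ (@snd 'rV[R]_(m * n) 'rV[R]_m) (fun M : 'rV[R]_m => M ord0 i)).
    exact: cvg_snd.
  exact: coord_continuous.
apply: (@continuous_comp _ _ _ (@fst 'rV[R]_(m * n) 'rV[R]_m)
  (fun M : 'rV[R]_(m * n) => M ord0 (mxvec_index i j))).
  exact: cvg_fst.
exact: coord_continuous.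
Qed.

(** The frame is flattened to a row vector, so that the compactness criterion for closed bounded
    sets of row vectors applies to sets of frames. *)
Definition spherical_section (v : 'rV[R]_(m * n)) : R :=
  fine (\int[sphere_measure m]_(y in sphere m)
    (radial_fun N f m.-1 (y *m vec_mx v))%:E)%E.

Let radial_joint (v : 'rV[R]_(m * n)) (y : 'rV[R]_m) :
  vec_mx v *m (vec_mx v)^T = 1%:M -> sphere m y ->
  {for (v, y), continuous (fun p : 'rV[R]_(m * n) * 'rV[R]_m =>
    radial_fun N f m.-1 (p.2 *m vec_mx p.1))}.
Proof.
move=> vv /sphere_neq0 y0.
apply: (@continuous_comp _ _ _ (fun p : 'rV[R]_(m * n) * 'rV[R]_m => p.2 *m vec_mx p.1)
  (radial_fun N f m.-1)); first exact: continuous_mulmx_vec.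
by apply: radial_fun_continuous => //=; exact: isometry_neq0.
Qed.

Lemma radial_fun_bounded_section (v : 'rV[R]_(m * n)) :
  vec_mx v *m (vec_mx v)^T = 1%:M ->
  exists2 M, 0 <= M & forall y, sphere m y -> radial_fun N f m.-1 (y *m vec_mx v) <= M.
Proof.
move=> vv; apply: compact_bounded_above; first exact: compact_sphere.
move=> y Sy; have := radial_joint vv Sy.
move=> h; apply: (@continuous_comp _ _ _ (fun y : 'rV[R]_m => (v, y))
  (fun p : 'rV[R]_(m * n) * 'rV[R]_m => radial_fun N f m.-1 (p.2 *m vec_mx p.1))) => //.
exact: (cvg_pair (@cvg_cst _ _ _ _ (nbhs_filter y)) cvg_id).
Qed.

(** An orthonormal frame maps the unit sphere into the complement of the origin, where the radial
    function is continuous; compactness of the sphere makes this uniform. *)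
Lemma spherical_section_continuous (v : 'rV[R]_(m * n)) :
  vec_mx v *m (vec_mx v)^T = 1%:M -> {for v, continuous spherical_section}.
Proof.
move=> vv; have [M _ vM] := radial_fun_bounded_section vv.
have := (@cvg_integral_uniform R _ _ (sphere_measure m) (sphere m)
  (@measurable_sphere m) (@sphere_measure_lty m) ('rV[R]_(m * n)) v
  (fun (v : 'rV[R]_(m * n)) (y : 'rV[R]_m) => radial_fun N f m.-1 (y *m vec_mx v)) M).
have mg (w : 'rV[R]_(m * n)) : measurable_fun (sphere m)
    (fun y : 'rV[R]_m => radial_fun N f m.-1 (y *m vec_mx w)).
  by apply: measurable_funTS; exact: measurable_radial_fun_mulmx.
have g0 (w : 'rV[R]_(m * n)) (y : 'rV[R]_m) : sphere m y ->
    0 <= radial_fun N f m.-1 (y *m vec_mx w).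
  by move=> _; exact: radial_fun_ge0.
move=> /(_ mg g0 vM); apply => e e0.
apply: (@near_uniform_compact R _ _ (sphere m)
    (fun (v : 'rV[R]_(m * n)) (y : 'rV[R]_m) => radial_fun N f m.-1 (y *m vec_mx v))
    v e (@compact_sphere m)) => // y Sy.
exact: radial_joint.
Qed.

Lemma spherical_section_fin_num (U : 'M[R]_(m, n)) : U *m U^T = 1%:M ->
  (\int[sphere_measure m]_(y in sphere m) (radial_fun N f m.-1 (y *m U))%:E)%E
    \is a fin_num.
Proof.
move=> UU; have := @radial_fun_bounded_section (mxvec U).
rewrite mxvecK => /(_ UU)[M _ vM].
apply: (ge0_integral_bounded_fin_num (@measurable_sphere m) (@sphere_measure_lty m) (M := M)).
  by apply: measurable_funTS; exact: measurable_radial_fun_mulmx.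
by move=> y Sy; rewrite radial_fun_ge0//= vM.
Qed.

End section_integral.

(** * Sections by subspaces *)

Section subspaces.
Context {R : realType}.
Local Notation leb := (@lebesgue_rV R).

Definition stiefel m n : set 'rV[R]_(m * n) :=
  [set v | vec_mx v *m (vec_mx v)^T = 1%:M :> 'M[R]_m].

(** Unit rows bound the entries, and orthonormality is a finite system of polynomial equations,
    hence a closed condition. *)
Lemma compact_stiefel m n : compact (@stiefel m n).
Proof.
apply: bounded_closed_compact.
  apply: (@bounded_set_coord _ _ _ 1) => v k vv.
  case/mxvec_indexP: k => i j.
  have -> : v ord0 (mxvec_index i j) = row i (vec_mx v : 'M[R]_(m, n)) ord0 j.
    by rewrite !mxE.
  apply: le_trans (ler_coord_enorm _ _) _.
  rewrite -(@expr_le1 _ 2) ?enorm_ge0// enorm_sqr.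
  have /matrixP/(_ i i) := vv; rewrite !mxE eqxx mulr1n => <-.
  by apply: ler_sum => l _; rewrite !mxE.
rewrite (_ : @stiefel m n = \bigcap_(i in [set: 'I_m]) \bigcap_(j in [set: 'I_m])
  [set v : 'rV[R]_(m * n) | \sum_k (vec_mx v i k * vec_mx v j k) = (i == j)%:R]).
  apply: closed_bigI => i _; apply: closed_bigI => j _.
  apply: (@closed_comp _ _ (fun v : 'rV[R]_(m * n) => \sum_k (vec_mx v i k * vec_mx v j k))
    [set (i == j)%:R]) => [v _|].
    apply: (cvg_sumr (nbhs_filter v)) => k; rewrite !mxE; under eq_fun do rewrite !mxE.
    by apply: cvgM; exact: coord_continuous.
  by apply: accessible_closed_set1; exact/hausdorff_accessible/Rhausdorff.
apply/seteqP; split => v.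
  move=> vv i _ j _ /=; have /matrixP/(_ i j) := vv; rewrite !mxE => <-.
  by apply: eq_bigr => k _; rewrite !mxE.
move=> vv; apply/matrixP => i j; rewrite !mxE -(vv i I j I).
by apply: eq_bigr => k _; rewrite !mxE.
Qed.

Section rowspan.
Variables (m n : nat) (U : 'M[R]_(m, n)).
Hypothesis UU : U *m U^T = 1%:M.

Definition rowspan : {vspace 'rV[R]_n} := limg (linfun (mulmxr U : 'rV[R]_m -> _)).

Lemma mem_rowspan (y : 'rV[R]_m) : y *m U \in rowspan.
Proof. by apply/memv_imgP; exists y; rewrite ?memvf// lfunE. Qed.

Lemma rowspanP x : x \in rowspan -> exists y : 'rV[R]_m, x = y *m U.
Proof. by move=> /memv_imgP[y _ ->]; exists y; rewrite lfunE. Qed.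

Lemma row_rowspan i : row i U \in rowspan.
Proof. by rewrite rowE mem_rowspan. Qed.

Lemma dim_rowspan : \dim rowspan = m.
Proof.
rewrite /rowspan limg_dim_eq ?dimvf /dim/= ?mul1n//.
apply/eqP; rewrite -subv0; apply/subvP => y; rewrite memv_cap memv_ker lfunE/= => /andP[_ /eqP yU].
by rewrite memv0 -[y]mulmx1 -UU mulmxA yU mul0mx.
Qed.

Lemma rowspan_sub (H : {vspace 'rV[R]_n}) :
  (forall i, row i U \in H) -> (rowspan <= H)%VS.
Proof.
move=> UH; apply/subvP => x /rowspanP[y ->].
rewrite mulmx_sum_row; apply: memv_suml => i _; exact: memvZ.
Qed.

Lemma rowspan_eq (H : {vspace 'rV[R]_n}) :
  (forall i, row i U \in H) -> \dim H = m -> H = rowspan.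
Proof.
move=> UH dH; apply/esym/eqP; rewrite eqEdim rowspan_sub//=.
by rewrite dH dim_rowspan.
Qed.

End rowspan.

(** The rows of V lie in the row space of U, so V = O U with O = V U^T. This O is orthogonal, and
    the two integrals differ by an orthogonal change of variables. *)
Lemma ge0_integral_orthonormal_basis m n (H : {vspace 'rV[R]_n})
    (U V : 'M[R]_(m, n)) (F : 'rV[R]_n -> \bar R) : \dim H = m ->
  U *m U^T = 1%:M -> V *m V^T = 1%:M ->
  (forall i, row i U \in H) -> (forall i, row i V \in H) ->
  measurable_fun setT F -> (forall x, 0 <= F x)%E ->
  (\int[leb m]_y F (y *m V)%R = \int[leb m]_y F (y *m U)%R)%E.
Proof.
move=> dH UU VV UH VH mF F0.
have VE : V *m U^T *m U = V.
  apply/row_matrixP => i; rewrite !row_mul.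
  have [y ->] : exists y : 'rV[R]_m, row i V = y *m U.
    by apply: rowspanP; rewrite -(rowspan_eq UU UH dH).
  by rewrite -!mulmxA (mulmxA U) UU mul1mx.
pose O := V *m U^T.
have OO : O *m O^T = 1%:M by rewrite /O trmx_mul trmxK mulmxA VE.
have mFU : measurable_fun setT (fun y : 'rV[R]_m => F (y *m U)).
  exact: (measurableT_comp mF (measurable_mulmxr U)).
have := ge0_integral_orthogonal OO mFU (fun y => F0 _).
by under eq_integral do rewrite -mulmxA VE.
Qed.

Lemma isometry_onto_mem n (H : {vspace 'rV[R]_n}) y : isometry_onto (H := H) y \in H.
Proof.
have [BB BH] := onbasisP H.
exact: (subvP (rowspan_sub BH)) (mem_rowspan _ y).
Qed.

Lemma isometry_ontoP n (H : {vspace 'rV[R]_n}) x : x \in H ->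
  exists y, x = isometry_onto (H := H) y.
Proof.
have [BB BH] := onbasisP H.
by move=> xH; apply: rowspanP; rewrite -(rowspan_eq BB BH erefl).
Qed.

(** H is the set of fixed points of its orthogonal projection, which amounts to one equation per
    coordinate. *)
Lemma measurable_subspace n (H : {vspace 'rV[R]_n}) : measurable [set` H].
Proof.
have [BB BH] := onbasisP H.
rewrite (_ : [set` H] = \bigcap_(j in [set: 'I_n])
   (fun x : 'rV[R]_n => (x *m orth_proj H) ord0 j - x ord0 j) @^-1` [set 0]).
  apply: fin_bigcap_measurable => // j _.
  rewrite -[X in measurable X]setTI.
  apply: measurable_funB; [|exact: (measurable_rV_coord j)|exact: measurableT|exact: measurable_set1].
  exact: (measurableT_comp (measurable_rV_coord j) (measurable_mulmxr (orth_proj H))).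
apply/seteqP; split => x /=.
  move=> /isometry_ontoP[y ->] j _ /=.
  by rewrite /isometry_onto /orth_proj -!mulmxA (mulmxA (onbasis H)) BB mul1mx subrr.
move=> h; have -> : x = x *m (onbasis H)^T *m onbasis H.
  apply/rowP => j; apply/eqP; rewrite eq_sym -subr_eq0 -mulmxA; apply/eqP.
  exact: (h j I).
exact: isometry_onto_mem.
Qed.

Lemma spherical_radonE n (H : {vspace 'rV[R]_n}) (h : 'rV[R]_n -> R) :
  measurable_fun setT h -> (forall x, 0 <= h x) ->
  spherical_radon h H =
  fine (\int[sphere_measure (\dim H)]_(y in sphere (\dim H)) (h (y *m onbasis H))%:E)%E.
Proof.
move=> mh h0; have [BB BH] := onbasisP H.
have mD : measurable (sphere n `&` [set` H]).
  apply: measurableI; first exact: measurable_sphere.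
  exact: measurable_subspace.
congr fine; have mEh : measurable_fun (sphere n `&` [set` H]) (EFin \o h).
  by apply/measurable_EFinP; apply: measurable_funTS.
apply: etrans.
  apply: (ge0_integral_image_measure (sphere_measure (\dim H)) (@isometry_onto R n H) mD mEh).
  by move=> x _; rewrite lee_fin.
rewrite (_ : _ @^-1` _ = sphere (\dim H))//.
apply/seteqP; split => y /=.
  by move=> [+ _]; rewrite /sphere/= /isometry_onto enorm_isometry.
move=> Sy; split; last exact: isometry_onto_mem.
by rewrite /sphere/= /isometry_onto enorm_isometry.
Qed.

Lemma integral_lebesgue_onE n (H : {vspace 'rV[R]_n}) (N f : 'rV[R]_n -> R) :
  gauge N -> continuous f -> (forall x, 0 <= f x) ->
  (\int[lebesgue_on H]_(x in [set x | (N x <= 1)%R] `&` [set` H]) (f x)%:E =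
   \int[leb (\dim H)]_y (body_fun N f (y *m onbasis H))%:E)%E.
Proof.
move=> gN cf f0.
have mD : measurable ([set x | N x <= 1] `&` [set` H]).
  apply: measurableI; first exact: measurable_gauge_le.
  exact: measurable_subspace.
have mEf : measurable_fun ([set x | N x <= 1] `&` [set` H]) (EFin \o f).
  by apply/measurable_EFinP; apply: measurable_funTS; exact: continuous_measurable_fun_rV.
apply: etrans.
  apply: (ge0_integral_image_measure (leb (\dim H)) (@isometry_onto R n H) mD mEf).
  by move=> x _; rewrite lee_fin.
rewrite integral_mkcond; apply: eq_integral => y _.
rewrite patchE /body_fun -/(isometry_onto y); case: ifPn => [/set_mem[/= -> _]//|].
case: ifPn => // Ny /negP; case; apply/mem_set; split => //.
exact: isometry_onto_mem.
Qed.

(** A vector of a complement raises the dimension by one. The point x is prescribed so that a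
    section can be drawn through any point where f is positive. *)
Lemma subspace_containing n m (x : 'rV[R]_n) : (0 < m <= n)%N ->
  exists2 H : {vspace 'rV[R]_n}, \dim H = m & x \in H.
Proof.
case/andP; elim: m => // -[|m] IH _ mn.
  (* The zero vector spans no line, but lies on that of the first coordinate vector. *)
  have [->|x0] := eqVneq x 0.
    pose w : 'rV[R]_n := delta_mx 0 (Ordinal mn).
    exists <[w]>%VS; last exact: mem0v.
    rewrite dim_vline; case: eqVneq => // /rowP/(_ (Ordinal mn)).
    by rewrite !mxE !eqxx => /eqP; rewrite oner_eq0.
  by exists <[x]>%VS; [rewrite dim_vline x0|exact: memv_line].
have [H dH xH] := IH isT (ltnW mn).
have : (H^C)%VS != 0%VS.
  rewrite -dimv_eq0 dimv_compl dimvf /dim/= mul1n dH -lt0n subn_gt0//.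
move=> HC0; pose v := vpick (H^C)%VS.
exists (H + <[v]>)%VS; last by apply: (subvP (addvSl _ _)).
rewrite dimv_disjoint_sum ?dH ?dim_vline ?vpick0 ?HC0 ?addn1//.
apply/eqP; rewrite -subv0; apply/subvP => y; rewrite memv_cap => /andP[yH yv].
rewrite -(capv_compl H) memv_cap yH/=.
by apply: subvP yv; rewrite -memvE memv_pick.
Qed.

End subspaces.

(** * Bounds for generalized intersection bodies *)

Section nonmeasurable_monotonicity.

(* Without measurability the integral is a lower integral, which is still
   monotone on non-negative functions. *)
Lemma ge0_le_integral_lower d (T : measurableType d) (R : realType)
    (mu : {measure set T -> \bar R}) (D : set T) (f g : T -> \bar R) :
  (forall x, D x -> 0 <= f x)%E -> (forall x, D x -> f x <= g x)%E ->
  (\int[mu]_(x in D) f x <= \int[mu]_(x in D) g x)%E.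
Proof.
move=> f0 fg; have g0 x : D x -> (0 <= g x)%E.
  by move=> Dx; apply: le_trans (fg x Dx); exact: f0.
rewrite !ge0_integralE//; apply: le_ereal_sup => _ [h hf <-]; exists h => // x.
apply: le_trans (hf x) _; rewrite !patchE; case: ifPn => // /set_mem; exact: fg.
Qed.

(** The bound M and the finite total mass make both integrals finite, so that [fine] preserves their
    order. *)
Lemma ge0_le_Rintegral_lower d (T : measurableType d) (R : realType)
    (mu : {finite_measure set T -> \bar R}) (D : set T) (f g : T -> R) (M : R) :
  (forall x, D x -> 0 <= f x <= g x) -> (forall x, D x -> g x <= M) ->
  (\int[mu]_(x in D) f x <= \int[mu]_(x in D) g x)%R.
Proof.
move=> fg gM; rewrite /Rintegral.
have le1 : (\int[mu]_(x in D) (f x)%:E <= \int[mu]_(x in D) (g x)%:E)%E.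
  apply: ge0_le_integral_lower => x /fg /andP[]; rewrite lee_fin//.
have le0 : (0 <= \int[mu]_(x in D) (f x)%:E)%E.
  by apply: integral_ge0 => x /fg /andP[h _]; rewrite lee_fin.
have goo : (\int[mu]_(x in D) (g x)%:E < +oo)%E.
  rewrite integral_mkcond.
  apply: (@le_lt_trans _ _ (\int[mu]_x (Num.max 0 M)%:E)%E).
    apply: ge0_le_integral_lower => x _; rewrite patchE; case: ifPn => [/set_mem Dx|_].
    - by have /andP[f0 fgx] := fg x Dx; rewrite lee_fin (le_trans f0).
    - by [].
    - by rewrite lee_fin le_max gM ?orbT.
    - by rewrite lee_fin le_max lexx.
  rewrite integral_cst// lte_mul_pinfty//; first by rewrite lee_fin le_max lexx.
  exact: fin_num_fun_lty.
by apply: fine_le => //; rewrite ge0_fin_numE// ?(le_lt_trans le1)// (le_trans le0).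
Qed.

End nonmeasurable_monotonicity.

(** * Negative powers of a gauge and the bathtub principle *)

Section volume_of_gauge_ball.
Context {R : realType}.
Local Notation mu := (@lebesgue_measure R).
Local Notation leb := (@lebesgue_rV R).

Lemma integral_expr01 j :
  (\int[mu]_(s in `]0%R, 1%R]) (s ^+ j)%:E = (j.+1%:R^-1)%:E)%E.
Proof.
have cX i : continuous (fun s : R => s ^+ i) by move=> s; exact: exprn_continuous.
rewrite integral_itv_obnd_cbnd; last first.
  by apply/measurable_EFinP; apply: measurable_funTS; exact: continuous_measurable_fun.
pose F (s : R) := j.+1%:R^-1 * s ^+ j.+1.
have dF (s : R) : is_derive s 1 F (s ^+ j).
  have dX := is_deriveX j.+1 (is_derive_id s (1 : R)).
  have := is_deriveZ j.+1%:R^-1 dX.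
  rewrite (_ : j.+1%:R^-1 \*: id ^+ j.+1 = F); last by apply/funext => r; rewrite /= exprfctE.
  move=> /is_derive_eq; apply.
  by rewrite /GRing.scale/= mulr1 mulrA mulVf ?mul1r// pnatr_eq0.
have cF : continuous F.
  by move=> s; apply: cvgM; [exact: cvg_cst|exact: cX].
rewrite (@continuous_FTC2 _ (fun s => s ^+ j) F 0 1)//.
- by rewrite /F expr1n expr0n/= mulr0 mulr1 sube0.
- by apply: continuous_subspaceT; exact: cX.
- split.
  + by move=> s _; have [] := dF s.
  + by apply: cvg_at_right_filter; exact: cF.
  + by apply: cvg_at_left_filter; exact: cF.
- by move=> s _; have [_ <-] := dF s; rewrite derive1E.
Qed.

Variable n : nat.
Variable N : 'rV[R]_n -> R.
Hypothesis gN : gauge N.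

Lemma radial_fun_cst1 j x : radial_fun N (cst 1) j x = (N x)^-1 ^+ j.+1 * j.+1%:R^-1.
Proof.
rewrite /radial_fun /segment_integral; congr (_ * _).
by under eq_integral do rewrite mulr1; rewrite integral_expr01.
Qed.

Hypothesis n0 : (0 < n)%N.

Let c1 : continuous (cst 1 : 'rV[R]_n -> R).
Proof. exact: cst_continuous. Qed.
Let c10 x : 0 <= (cst 1 : 'rV[R]_n -> R) x. Proof. exact: ler01. Qed.

Let inv_gauge_ge0 k x : 0 <= (N x)^-1 ^+ k.
Proof. by rewrite exprn_ge0// invr_ge0 gauge_ge0. Qed.

Lemma measurable_inv_gauge k : measurable_fun setT (fun x => (N x)^-1 ^+ k).
Proof.
rewrite (_ : (fun x => _) = fun x => (N x `^ (-1)) ^+ k); last first.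
  by apply/funext => x; rewrite powR_inv1// gauge_ge0.
apply: measurable_funX; apply: (measurableT_comp (@measurable_powR R (-1))).
by apply: continuous_measurable_fun_rV; case: gN.
Qed.

(** On a ray N(rx)^-k = r^-k N(x)^-k: the factor r^-k lowers the polar weight r^(n-1) to r^(m-1),
    the weight of an m-dimensional section, and N(x)^-k leaves the ray integral. *)
Lemma integral_inv_gauge_polar (m k : nat) (Phi : 'rV[R]_n -> \bar R) :
  (0 < m)%N -> n = (m + k)%N ->
  measurable_fun setT Phi -> (forall x, 0 <= Phi x)%E ->
  (\int[leb n]_x (((N x)^-1 ^+ k)%:E * Phi x) =
   \int[sphere_measure n]_(x in sphere n)
     (((N x)^-1 ^+ k)%:E * ray_integral m.-1 Phi x))%E.
Proof.
move=> m0 nmk mPhi Phi0.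
have mW : measurable_fun setT (fun x => (((N x)^-1 ^+ k)%:E * Phi x)%E).
  by apply: emeasurable_funM => //; apply/measurable_EFinP; exact: measurable_inv_gauge.
have W0 x : (0 <= ((N x)^-1 ^+ k)%:E * Phi x)%E.
  by apply: mule_ge0 => //; rewrite lee_fin.
rewrite (polar_integral n0 mW W0).
apply: eq_integral => x /set_mem/sphere_neq0 x0.
have c0 : (0 <= ((N x)^-1 ^+ k)%:E)%E by rewrite lee_fin.
have mr := measurable_ray_integrand_r m.-1 mPhi x.
have r0 r : setT r -> (0 <= (ray_weight m.-1 r)%:E * Phi (r *: x)%R)%E.
  by move=> _; exact: ray_integrand_ge0.
apply: etrans (ge0_integralZl mu measurableT mr r0 c0).
apply: eq_integral => r _.
have [rle|rgt] := leP r 0; first by rewrite !ray_weight_le0// !mul0e mule0.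
rewrite !ray_weight_gt0// !muleA -!EFinM; congr (_%:E * _)%E.
have [_ NZ _] := gN; rewrite (NZ _ _ (ltW rgt)) invfM exprMn.
have -> : n.-1 = (m.-1 + k)%N by rewrite nmk; case: (m) m0.
rewrite exprD mulrACA -(mulrA (r ^+ m.-1)).
have rr : r ^+ k * r^-1 ^+ k = 1 by rewrite -exprMn divff ?gt_eqF// expr1n.
transitivity ((N x)^-1 ^+ k * r ^+ m.-1 * (r ^+ k * r^-1 ^+ k)); first by ring.
by rewrite rr mulr1.
Qed.

Let V := lebesgue_rV n [set x | N x <= 1].

Let body1 : (\int[leb n]_x (body_fun N (cst 1) x)%:E = V)%E.
Proof.
rewrite /V -(integral_indicT (leb n)); last exact: measurable_gauge_le.
apply: eq_integral => x _; rewrite /body_fun indicE.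
case: ifPn => h; first by rewrite mem_set.
by rewrite memNset//=; apply/negP.
Qed.

Lemma volume_gauge_polar :
  (n%:R%:E * V = \int[sphere_measure n]_(x in sphere n) ((N x)^-1 ^+ n)%:E)%E.
Proof.
have mF : measurable_fun setT (fun x => (body_fun N (cst 1) x)%:E).
  by apply/measurable_EFinP; exact: measurable_body_fun.
rewrite -body1 (polar_integral n0 mF); last first.
  by move=> x; rewrite lee_fin; exact: body_fun_ge0.
rewrite -ge0_integralZl//.
- apply: eq_integral => x /set_mem/sphere_neq0 x0.
  rewrite [ray_integral _ _ _](ray_integral_body_fun gN c1 c10 n.-1 x0).
  rewrite radial_fun_cst1 prednK// -EFinM mulrCA mulfV ?mulr1//.
  by rewrite pnatr_eq0 -lt0n.
- exact: measurable_sphere.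
- apply: measurable_funTS; apply: measurable_ray_integral => // x.
  by rewrite lee_fin; exact: body_fun_ge0.
- move=> x _; apply: ray_integral_ge0 => y.
  by rewrite lee_fin; exact: body_fun_ge0.
Qed.

(** In polar coordinates the integrand is N^-k N^-m / m = N^-n / m, whereas the volume has N^-n / n.
    This quotient is the origin of the constant n/m. *)
Lemma integral_inv_gauge_ball (m k : nat) : (0 < m)%N -> n = (m + k)%N ->
  (\int[leb n]_x (((N x)^-1 ^+ k)%:E * (body_fun N (cst 1) x)%:E) =
   (n%:R / m%:R)%:E * V)%E.
Proof.
move=> m0 nmk.
have mF : measurable_fun setT (fun x => (body_fun N (cst 1) x)%:E).
  by apply/measurable_EFinP; exact: measurable_body_fun.
rewrite (integral_inv_gauge_polar m0 nmk mF); last first.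
  by move=> x; rewrite lee_fin; exact: body_fun_ge0.
have mi : (0 <= (m%:R^-1 : R)%:E)%E by rewrite lee_fin invr_ge0.
rewrite mulrC EFinM -muleA volume_gauge_polar.
have mn : measurable_fun (sphere n) (fun x => ((N x)^-1 ^+ n)%:E).
  by apply/measurable_EFinP; apply: measurable_funTS; exact: measurable_inv_gauge.
apply: etrans; last first.
  apply: (ge0_integralZl (sphere_measure n) (@measurable_sphere R n) mn) => //.
  by move=> x _; rewrite lee_fin.
apply: eq_integral => x /set_mem/sphere_neq0 x0.
rewrite [ray_integral _ _ _](ray_integral_body_fun gN c1 c10 m.-1 x0).
rewrite radial_fun_cst1 prednK// -!EFinM; congr EFin.
by rewrite nmk exprD; ring.
Qed.

(* Bathtub principle: (N^-k - 1)(1_{N <= 1} - G) >= 0 off the origin. *)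
Lemma bathtub (m k : nat) (G : 'rV[R]_n -> R) : (0 < m)%N -> n = (m + k)%N ->
  measurable_fun setT G -> (forall x, 0 <= G x <= 1) ->
  (\int[leb n]_x (((N x)^-1 ^+ k)%:E * (G x)%:E) + V <=
   (n%:R / m%:R)%:E * V + \int[leb n]_x (G x)%:E)%E.
Proof.
move=> m0 nmk mG G01.
have G0 x : 0 <= G x by have /andP[] := G01 x.
have mB : measurable_fun setT (body_fun N (cst 1)) by exact: measurable_body_fun.
have B0 x : 0 <= body_fun N (cst 1) x by exact: body_fun_ge0.
have mW := measurable_inv_gauge k.
rewrite -(integral_inv_gauge_ball m0 nmk) -body1.
have mWG : measurable_fun setT (fun x => (((N x)^-1 ^+ k)%:E * (G x)%:E)%E).
  by apply: emeasurable_funM; exact/measurable_EFinP.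
have mWB : measurable_fun setT
    (fun x => (((N x)^-1 ^+ k)%:E * (body_fun N (cst 1) x)%:E)%E).
  by apply: emeasurable_funM; exact/measurable_EFinP.
have mEG : measurable_fun setT (fun x => (G x)%:E) by exact/measurable_EFinP.
have mEB : measurable_fun setT (fun x => (body_fun N (cst 1) x)%:E).
  exact/measurable_EFinP.
have WG0 x : setT x -> (0 <= ((N x)^-1 ^+ k)%:E * (G x)%:E)%E.
  by move=> _; apply: mule_ge0; rewrite lee_fin.
have WB0 x : setT x -> (0 <= ((N x)^-1 ^+ k)%:E * (body_fun N (cst 1) x)%:E)%E.
  by move=> _; apply: mule_ge0; rewrite lee_fin.
have EG0 x : setT x -> (0 <= (G x)%:E)%E by rewrite lee_fin.
have EB0 x : setT x -> (0 <= (body_fun N (cst 1) x)%:E)%E by rewrite lee_fin.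
(* Sums are compared rather than differences, as the integrals are not yet known to be finite. *)
have D1 := ge0_integralD (leb n) measurableT WG0 mWG EB0 mEB.
have D2 := ge0_integralD (leb n) measurableT WB0 mWB EG0 mEG.
rewrite -D1 -D2; apply: ae_ge0_le_integral.
- exact: measurableT.
- by move=> x Tx; rewrite adde_ge0 ?WG0 ?EB0.
- exact: emeasurable_funD.
- by move=> x Tx; rewrite adde_ge0 ?WB0 ?EG0.
- exact: emeasurable_funD.
exists [set 0]; split.
- by apply: closed_measurable_rV; exact: closed_set0_rV.
- by case: (n) n0 => // n' _; exact: lebesgue_rV_set0.
move=> x /=; apply: contra_notP => /eqP x0 _.
rewrite -!EFinM -!EFinD lee_fin.
have Nx : 0 < N x by case: gN => _ _; exact.
have /andP[_ G1] := G01 x.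
have G0x := G0 x.
rewrite /body_fun; case: ifPn => [N1|N1] /=.
  have W1 : 1 <= (N x)^-1 ^+ k by rewrite exprn_ege1// invf_ge1.
  have := mulr_ge0 (_ : 0 <= (N x)^-1 ^+ k - 1) (_ : 0 <= 1 - G x).
  by rewrite !subr_ge0 => /(_ W1 G1); lra.
have W1 : (N x)^-1 ^+ k <= 1.
  apply: exprn_ile1; first by rewrite invr_ge0 ltW.
  by rewrite invf_le1// ltW// ltNge.
by rewrite mulr0 addr0 add0r ler_piMl.
Qed.

End volume_of_gauge_ball.

(** * Bounds for dual mixed volumes *)

Section dual_mixed_volume_bounds.
Context {R : realType}.
Local Notation leb := (@lebesgue_rV R).
Variables (n m k : nat).
Hypotheses (m0 : (0 < m)%N) (nmk : n = (m + k)%N).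

Let n0 : (0 < n)%N. Proof. by rewrite nmk ltn_addr. Qed.

Lemma integral_inv_gauge_radial_fun (N M f : 'rV[R]_n -> R) :
  gauge N -> gauge M -> continuous f -> (forall x, 0 <= f x) ->
  (\int[sphere_measure n]_(x in sphere n)
     ((M x)^-1 ^+ k * radial_fun N f m.-1 x)%:E =
   \int[leb n]_x (((M x)^-1 ^+ k)%:E * (body_fun N f x)%:E))%E.
Proof.
move=> gN gM cf f0.
have mF : measurable_fun setT (fun x => (body_fun N f x)%:E).
  by apply/measurable_EFinP; exact: measurable_body_fun.
rewrite (integral_inv_gauge_polar gM n0 m0 nmk mF); last first.
  by move=> x; rewrite lee_fin; exact: body_fun_ge0.
apply: eq_integral => x /set_mem/sphere_neq0 x0.
by rewrite [ray_integral _ _ _](ray_integral_body_fun gN cf f0 m.-1 x0) EFinM.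
Qed.

(** On the body of N one has M <= 1, so the weight M^-k is at least 1 there, except possibly at the
    origin, where M vanishes. *)
Lemma integral_body_fun_le_radial (N M f : 'rV[R]_n -> R) :
  gauge N -> gauge M -> (forall x, N x <= 1 -> M x <= 1) ->
  continuous f -> (forall x, 0 <= f x) ->
  (\int[leb n]_x (body_fun N f x)%:E <=
   \int[sphere_measure n]_(x in sphere n)
     ((M x)^-1 ^+ k * radial_fun N f m.-1 x)%:E)%E.
Proof.
move=> gN gM NM cf f0.
rewrite integral_inv_gauge_radial_fun//.
have mF : measurable_fun setT (fun x => (body_fun N f x)%:E).
  by apply/measurable_EFinP; exact: measurable_body_fun.
have F0 x : (0 <= (body_fun N f x)%:E)%E by rewrite lee_fin; exact: body_fun_ge0.
apply: ae_ge0_le_integral.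
- exact: measurableT.
- by move=> x _; exact: F0.
- exact: mF.
- by move=> x _; apply: mule_ge0 => //; rewrite lee_fin exprn_ge0// invr_ge0 gauge_ge0.
- by apply: emeasurable_funM => //; apply/measurable_EFinP; exact: measurable_inv_gauge.
exists [set 0]; split.
- by apply: closed_measurable_rV; exact: closed_set0_rV.
- by case: (n) n0 => // n' _; exact: lebesgue_rV_set0.
move=> x /=; apply: contra_notP => /eqP x0 _.
rewrite -EFinM lee_fin /body_fun; case: ifPn => [N1|_]; last by rewrite mulr0.
have Mx : 0 < M x by case: gM => _ _; exact.
by rewrite ler_peMl// exprn_ege1// invf_ge1// NM.
Qed.

Lemma gauge_scale (N : 'rV[R]_n -> R) (c : R) : 0 < c -> gauge N ->
  gauge (fun x => c * N x).
Proof.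
move=> c0 [cN NZ N0]; split.
- by move=> x; apply: (@continuousM R _ (cst c) N); [exact: cst_continuous|exact: cN].
- by move=> a x a0; rewrite NZ// mulrCA.
- by move=> x x0; rewrite mulr_gt0// N0.
Qed.

Lemma lebesgue_gauge_ball_scale (N : 'rV[R]_n -> R) (t : R) : 0 < t -> gauge N ->
  (leb n [set x | (t^-1 * N x <= 1)%R] = (t ^+ n)%:E * leb n [set x | (N x <= 1)%R])%E.
Proof.
move=> t0 gN; have t0' : 0 < t^-1 by rewrite invr_gt0.
have mD := measurable_gauge_le gN 1.
have mf : measurable_fun setT (fun x => (\1_[set x | N x <= 1] x)%:E : \bar R).
  by apply/measurable_EFinP; exact: measurable_indic.
have f0 x : (0 <= (\1_[set x | N x <= 1] x)%:E :> \bar R)%E by rewrite lee_fin.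
have := ge0_integral_affine_rV 0 t0' mf f0.
rewrite invrK (integral_indicT (leb n) mD) => <-.
rewrite -(integral_indicT (leb n)); last first.
  exact: (measurable_gauge_le (gauge_scale t0' gN)).
apply: eq_integral => x _; rewrite addr0 !indicE; congr ((_ : bool)%:R%:E).
have [_ NZ _] := gN.
by apply/idP/idP => /set_mem h; apply/mem_set; move: h; rewrite /= NZ// ltW.
Qed.

Lemma lebesgue_gauge_ball_gt0 (N : 'rV[R]_n -> R) : gauge N ->
  (0 < leb n [set x | (N x <= 1)%R])%E.
Proof.
move=> gN; have cN : continuous N by case: gN.
have oV : open [set x : 'rV[R]_n | N x < 1].
  apply: (@open_comp _ _ N [set r | r < 1]) => [x _|]; first exact: cN.
  exact: open_lt.
apply: (@lt_le_trans _ _ (leb n [set x | N x < 1])).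
  by apply: (lebesgue_rV_open_gt0 oV (x := 0)); rewrite /= gauge0.
apply: le_measure; rewrite ?inE.
- exact: open_measurable_rV.
- exact: measurable_gauge_le.
- by move=> x /= /ltW.
Qed.

(** The bathtub bound is applied to the dilate with gauge t^-1 N, where t^n = I / V makes its volume
    equal to I. The two terms I then cancel and n/m I remains; returning to the weight N^-k costs
    the factor t^-k = (V / I)^(k/n). *)
Lemma integral_inv_gauge_bathtub (N G : 'rV[R]_n -> R) (V I : R) :
  gauge N -> measurable_fun setT G -> (forall x, 0 <= G x <= 1) ->
  leb n [set x | N x <= 1] = V%:E -> 0 < V ->
  (\int[leb n]_x (G x)%:E = I%:E)%E -> 0 < I ->
  (\int[leb n]_x (((N x)^-1 ^+ k)%:E * (G x)%:E) <=
   (n%:R / m%:R * (V `^ (k%:R / n%:R) * I `^ (m%:R / n%:R)))%:E)%E.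
Proof.
move=> gN mG G01 VE V0 IE I0.
have nz : n%:R != 0 :> R by rewrite pnatr_eq0 -lt0n.
pose t := (I / V) `^ n%:R^-1.
have IV0 : 0 < I / V by rewrite divr_gt0.
have t0 : 0 < t by rewrite powR_gt0.
have tn : t ^+ n = I / V.
  by rewrite -powR_mulrn ?powR_ge0// -powRrM mulVf// powRr1// ltW.
have t0' : 0 < t^-1 by rewrite invr_gt0.
have gN' := gauge_scale t0' gN.
have V'E : leb n [set x | t^-1 * N x <= 1] = I%:E.
  by rewrite lebesgue_gauge_ball_scale// VE -EFinM tn divfK// gt_eqF.
have := bathtub gN' n0 m0 nmk mG G01.
rewrite V'E IE leeD2rE// => X'le.
have mW : measurable_fun setT (fun x => (((N x)^-1 ^+ k)%:E * (G x)%:E)%E).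
  by apply: emeasurable_funM; apply/measurable_EFinP => //; exact: measurable_inv_gauge.
have W0 x : setT x -> (0 <= ((N x)^-1 ^+ k)%:E * (G x)%:E)%E.
  move=> _; apply: mule_ge0; rewrite lee_fin; last by have /andP[] := G01 x.
  by rewrite exprn_ge0// invr_ge0 gauge_ge0.
have tk : (0 <= (t^-1 ^+ k)%:E)%E by rewrite lee_fin exprn_ge0// ltW.
have -> : (\int[leb n]_x (((N x)^-1 ^+ k)%:E * (G x)%:E) =
    (t^-1 ^+ k)%:E * \int[leb n]_x (((t^-1 * N x)^-1 ^+ k)%:E * (G x)%:E))%E.
  have mW' : measurable_fun setT (fun x => (((t^-1 * N x)^-1 ^+ k)%:E * (G x)%:E)%E).
    by apply: emeasurable_funM; apply/measurable_EFinP => //; exact: (measurable_inv_gauge gN').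
  have W'0 x : setT x -> (0 <= ((t^-1 * N x)^-1 ^+ k)%:E * (G x)%:E)%E.
    move=> _; apply: mule_ge0; rewrite lee_fin; last by have /andP[] := G01 x.
    by rewrite exprn_ge0// invr_ge0 (gauge_ge0 gN').
  apply: etrans; last exact: (ge0_integralZl (leb n) measurableT mW' W'0 tk).
  apply: eq_integral => x _; rewrite [RHS]muleA; congr (_ * _)%E.
  by rewrite -EFinM -exprMn invfM invrK mulrA mulVf ?gt_eqF// mul1r.
apply: (le_trans (lee_wpmul2l tk X'le)).
rewrite -!EFinM lee_fin mulrCA ler_wpM2l ?divr_ge0//.
have tkE : t ^+ k = (I / V) `^ (k%:R / n%:R).
  by rewrite -powR_mulrn ?powR_ge0// -powRrM (mulrC n%:R^-1).
have IE' : I = I `^ (m%:R / n%:R) * I `^ (k%:R / n%:R).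
  rewrite -powRD; last by rewrite (gt_eqF I0) implybT.
  by rewrite -mulrDl -natrD -nmk divff// powRr1// ltW.
have pV : 0 < V `^ (k%:R / n%:R) by rewrite powR_gt0.
have pI : 0 < I `^ (k%:R / n%:R) by rewrite powR_gt0.
have tkE' : t ^+ k * V `^ (k%:R / n%:R) = I `^ (k%:R / n%:R).
  by rewrite tkE -powRM ?divr_ge0 ?ltW// divfK// gt_eqF.
rewrite exprVn {1}IE' -tkE' mulrA mulrC.
rewrite [leLHS](_ : _ = V `^ (k%:R / n%:R) * I `^ (m%:R / n%:R))//.
have tk0 : t ^+ k != 0 by rewrite expf_neq0// gt_eqF.
by field.
Qed.

End dual_mixed_volume_bounds.

(** * Sections of star bodies *)

Section star_body_sections.
Context {R : realType}.
Local Notation leb := (@lebesgue_rV R).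
Variable n : nat.

(** The radial retraction onto the body {N <= 1}. Composition with it extends a function continuous
    on the body to the whole space without changing it on the body; the maximum with 1 keeps the
    denominator away from 0. *)
Definition gauge_retract (N : 'rV[R]_n -> R) (x : 'rV[R]_n) : 'rV[R]_n :=
  (Num.max 1 (N x))^-1 *: x.

Section gauge_retract.
Variable N : 'rV[R]_n -> R.
Hypothesis gN : gauge N.

Lemma gauge_retract_id x : N x <= 1 -> gauge_retract N x = x.
Proof. by move=> N1; rewrite /gauge_retract max_l// invr1 scale1r. Qed.

Lemma gauge_retract_le1 x : N (gauge_retract N x) <= 1.
Proof.
have [_ NZ _] := gN.
have m0 : 0 < Num.max 1 (N x) by rewrite lt_max ltr01.
rewrite /gauge_retract NZ; last by rewrite invr_ge0 ltW.
by rewrite mulrC ler_pdivrMr// mul1r le_max lexx orbT.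
Qed.

Lemma gauge_retract_continuous : continuous (gauge_retract N).
Proof.
have [cN _ _] := gN.
move=> x; apply: (@continuousZ _ _ _ (fun x => (Num.max 1 (N x))^-1) id); last exact: cvg_id.
apply: (@continuous_comp _ _ _ (fun x => Num.max 1 (N x)) (fun r : R => r^-1)).
  by apply: continuous_max; [exact: cst_continuous|exact: cN].
by apply: inv_continuous; rewrite gt_eqF// lt_max ltr01.
Qed.

Lemma continuous_comp_retract (K : set 'rV[R]_n) (f : 'rV[R]_n -> R) :
  (forall x, K x <-> N x <= 1) -> {within K, continuous f} ->
  continuous (f \o gauge_retract N).
Proof.
move=> KN /subspace_continuousP cf x U nU.
have Kr y : K (gauge_retract N y) by apply/KN; exact: gauge_retract_le1.
have H : \forall y \near x, K (gauge_retract N y) -> U (f (gauge_retract N y)).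
  exact: (@gauge_retract_continuous x _ (cf _ (Kr x) U nU)).
have : \forall y \near x, U ((f \o gauge_retract N) y).
  by apply: filterS H => y /=; apply.
by [].
Qed.

End gauge_retract.

Variables (N f : 'rV[R]_n -> R).
Hypotheses (gN : gauge N) (cf : continuous f) (f0 : forall x, 0 <= f x).

(** Strictness of N < 1 keeps a neighbourhood of y in the body; on a smaller one f exceeds half of
    its value at y U. *)
Lemma integral_body_fun_gt0 m (U : 'M[R]_(m, n)) (y : 'rV[R]_m) :
  N (y *m U) < 1 -> 0 < f (y *m U) ->
  (0 < \int[leb m]_y (body_fun N f (y *m U))%:E)%E.
Proof.
move=> N1 fy0; have cN : continuous N by case: gN.
have cU : continuous (fun z : 'rV[R]_m => z *m U).
  move=> z; apply: (cvg_rV (nbhs_filter z)) => j; rewrite mxE; under eq_fun do rewrite mxE.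
  apply: (cvg_sumr (nbhs_filter z)) => i.
  apply: cvgM; last exact: (@cvg_cst _ _ _ _ (nbhs_filter z)).
  exact: coord_continuous.
have cNU : continuous (fun z : 'rV[R]_m => N (z *m U)).
  by move=> z; apply: (@continuous_comp _ _ _ (fun z : 'rV[R]_m => z *m U) N); [exact: cU|exact: cN].
have cfU : continuous (fun z : 'rV[R]_m => f (z *m U)).
  by move=> z; apply: (@continuous_comp _ _ _ (fun z : 'rV[R]_m => z *m U) f); [exact: cU|exact: cf].
apply: (@ge0_integral_gt0_open _ _ _
  ([set z | N (z *m U) < 1] `&` [set z | f (y *m U) / 2 < f (z *m U)]) y (f (y *m U) / 2)).
- exact: measurable_body_fun_mulmx.
- by move=> z; rewrite lee_fin; exact: body_fun_ge0.
- apply: openI.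
    apply: (@open_comp _ _ (fun z : 'rV[R]_m => N (z *m U)) [set r | r < 1]) => [z _|].
      exact: cNU.
    exact: open_lt.
  apply: (@open_comp _ _ (fun z : 'rV[R]_m => f (z *m U)) [set r | f (y *m U) / 2 < r]) => [z _|].
    exact: cfU.
  exact: open_gt.
- by split => //=; rewrite ltr_pdivrMr// ltr_pMr// ltr1n.
- by rewrite divr_gt0.
- move=> z [/= zN zf]; rewrite /body_fun ifT; last exact: ltW.
  by rewrite lee_fin ltW.
Qed.

(** [onbasis H] is an arbitrary choice for each H. Freedom of the orthonormal basis is what allows
    section integrals to be studied as functions of a frame. *)
Lemma section_integralE m (H : {vspace 'rV[R]_n}) (U : 'M[R]_(m, n)) :
  \dim H = m -> U *m U^T = 1%:M -> (forall i, row i U \in H) ->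
  (\int[lebesgue_on H]_(x in [set x | (N x <= 1)%R] `&` [set` H]) (f x)%:E =
   \int[leb m]_y (body_fun N f (y *m U))%:E)%E.
Proof.
move=> dH; case: m / dH U => U UU UH.
rewrite integral_lebesgue_onE//.
have [BB BH] := onbasisP H.
apply: (ge0_integral_orthonormal_basis (F := EFin \o body_fun N f) erefl UU BB UH BH).
  by apply/measurable_EFinP; exact: measurable_body_fun.
by move=> x; rewrite lee_fin; exact: body_fun_ge0.
Qed.

Lemma spherical_radon_radial_fun m (H : {vspace 'rV[R]_n}) : (0 < m)%N ->
  \dim H = m ->
  spherical_radon (radial_fun N f m.-1) H =
  fine (\int[lebesgue_on H]_(x in [set x | (N x <= 1)%R] `&` [set` H]) (f x)%:E)%E.
Proof.
move=> m0 dH; case: m / dH m0 => m0.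
have [BB BH] := onbasisP H.
rewrite spherical_radonE; last 2 first.
- exact: measurable_radial_fun.
- by move=> x; exact: radial_fun_ge0.
by rewrite (section_integralE erefl BB BH) (integral_body_fun_polar m0 gN cf f0 BB).
Qed.

Lemma section_integral_fin_num m (U : 'M[R]_(m, n)) : (0 < m)%N -> U *m U^T = 1%:M ->
  (\int[leb m]_y (body_fun N f (y *m U))%:E)%E \is a fin_num.
Proof.
move=> m0 UU; rewrite (integral_body_fun_polar m0 gN cf f0 UU).
exact: spherical_section_fin_num.
Qed.

End star_body_sections.

(** * Comparison through the measure of an intersection body *)

Section key_inequality.
Context {R : realType}.
Local Notation leb := (@lebesgue_rV R).

Lemma star_body_setE n (K : set 'rV[R]_n) : star_body K ->
  K = [set x | minkowski_functional K x <= 1].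
Proof. by move=> hK; apply/seteqP; split => x; rewrite /= (star_bodyE hK). Qed.

Lemma fine_leP (X : \bar R) (r : R) : (0 <= X)%E -> (X <= r%:E)%E -> fine X <= r.
Proof. by case: X. Qed.

Lemma body_funZ n (N f : 'rV[R]_n -> R) (c : R) x :
  body_fun N (fun x => c * f x) x = c * body_fun N f x.
Proof. by rewrite /body_fun; case: ifP => // _; rewrite mulr0. Qed.

Lemma mulmx1_integral n (F : 'rV[R]_n -> \bar R) :
  (\int[leb n]_y F (y *m 1%:M)%R = \int[leb n]_y F y)%E.
Proof. by apply: eq_integral => y _; rewrite mulmx1. Qed.

Lemma body_fun_fin_num n (N f : 'rV[R]_n -> R) : (0 < n)%N -> gauge N ->
  continuous f -> (forall x, 0 <= f x) ->
  (\int[leb n]_x (body_fun N f x)%:E)%E \is a fin_num.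
Proof.
move=> n0 gN cf f0; rewrite -(mulmx1_integral (fun x => (body_fun N f x)%:E)).
by apply: section_integral_fin_num => //; rewrite mul1mx trmx1.
Qed.

Variables (n m k : nat).
Hypotheses (m0 : (0 < m)%N) (nmk : n = (m + k)%N).
Let n0 : (0 < n)%N. Proof. by rewrite nmk ltn_addr. Qed.

Let radial_within (N f : 'rV[R]_n -> R) : gauge N -> continuous f ->
  (forall x, 0 <= f x) -> {within sphere n, continuous (radial_fun N f m.-1)}.
Proof.
move=> gN cf f0; apply: continuous_in_subspaceT => x /set_mem/sphere_neq0.
exact: radial_fun_continuous.
Qed.

(** The values are those of a continuous function on the compact set of frames. The bound makes
    integrals of Radon transforms against a finite measure finite. *)
Lemma spherical_radon_bounded (N f : 'rV[R]_n -> R) : gauge N -> continuous f ->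
  (forall x, 0 <= f x) ->
  exists M, forall H, \dim H = m -> spherical_radon (radial_fun N f m.-1) H <= M.
Proof.
move=> gN cf f0.
have [M _ hM] := compact_bounded_above (@compact_stiefel R m n)
  (fun v vv => spherical_section_continuous gN cf f0 vv).
exists M => H dH; rewrite (spherical_radon_radial_fun gN cf f0 m0 dH).
have [U [UU UH]] := orthonormal_basis_exists dH.
rewrite (section_integralE gN cf f0 dH UU UH) (integral_body_fun_polar m0 gN cf f0 UU).
by have := hM (mxvec U); rewrite /stiefel /spherical_section /= mxvecK; exact.
Qed.

Let sphere_fin_num (M N f : 'rV[R]_n -> R) : gauge M -> gauge N -> continuous f ->
  (forall x, 0 <= f x) ->
  (\int[sphere_measure n]_(x in sphere n)
     ((M x)^-1 ^+ k * radial_fun N f m.-1 x)%:E)%E \is a fin_num.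
Proof.
move=> gM gN cf f0.
have [C _ hC] : exists2 C, 0 <= C & forall x, sphere n x ->
    (M x)^-1 ^+ k * radial_fun N f m.-1 x <= C.
  apply: compact_bounded_above; first exact: compact_sphere.
  move=> x /sphere_neq0 x0.
  apply: (@continuousM R _ (fun x => (M x)^-1 ^+ k) (radial_fun N f m.-1)); last first.
    exact: radial_fun_continuous.
  have [cM _ M0] := gM.
  apply: (@continuous_comp _ _ _ (fun x => (M x)^-1) (fun r : R => r ^+ k)); last first.
    exact: exprn_continuous.
  apply: (@continuous_comp _ _ _ M (fun r : R => r^-1)); first exact: cM.
  by apply: inv_continuous; rewrite gt_eqF// M0.
apply: (@ge0_integral_bounded_fin_num _ _ _ (sphere_measure n) (sphere n)
  (@measurable_sphere R n) (@sphere_measure_lty R n)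
  (fun x => (M x)^-1 ^+ k * radial_fun N f m.-1 x) C).
  apply: measurable_funTS; apply: measurable_funM; first exact: measurable_inv_gauge.
  exact: measurable_radial_fun.
move=> x Sx; rewrite hC// andbT mulr_ge0 ?radial_fun_ge0//.
by rewrite exprn_ge0// invr_ge0 gauge_ge0.
Qed.

Lemma key_inequality (N L f g : 'rV[R]_n -> R) (D : set 'rV[R]_n) (eps V I : R) :
  gauge N -> gauge L -> continuous f -> (forall x, 0 <= f x) ->
  continuous g -> (forall x, 0 <= g x) -> (forall x, L x <= 1 -> g x <= 1) ->
  gen_intersection_body k D -> [set x | N x <= 1] `<=` D -> 0 <= eps ->
  (forall H, \dim H = m ->
     fine (\int[lebesgue_on H]_(x in [set x | (N x <= 1)%R] `&` [set` H]) (f x)%:E)%E <=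
     eps * fine (\int[lebesgue_on H]_(x in [set x | (L x <= 1)%R] `&` [set` H]) (g x)%:E)%E) ->
  leb n D = V%:E -> 0 < V ->
  (\int[leb n]_x (body_fun L g x)%:E = I%:E)%E -> 0 < I ->
  fine (\int[leb n]_x (body_fun N f x)%:E)%E <=
  eps * (n%:R / m%:R * (V `^ (k%:R / n%:R) * I `^ (m%:R / n%:R))).
Proof.
move=> gN gL cf f0 cg g0 g1 [hD _ [nu hnu]] ND eps0 sec VE V0 IE I0.
pose M := minkowski_functional D.
have gM : gauge M by exact: star_body_gauge.
have DE := star_body_setE hD.
(* With eps absorbed into g, the hypothesis on sections is a pointwise inequality between two Radon
   transforms; linearity extracts eps again at the end. *)
pose g' x := eps * g x.
have cg' : continuous g'.
  by move=> x; apply: (@continuousM R _ (cst eps) g); [exact: cst_continuous|exact: cg].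
have g'0 x : 0 <= g' x by rewrite mulr_ge0.
pose h1 := radial_fun N f m.-1; pose h2 := radial_fun L g' m.-1.
have nk : (n - k)%N = m by rewrite nmk addnK.
have radon_le H : \dim H = m -> 0 <= spherical_radon h1 H <= spherical_radon h2 H.
  move=> dH; rewrite (spherical_radon_radial_fun gN cf f0 m0 dH).
  rewrite (spherical_radon_radial_fun gL cg' g'0 m0 dH).
  apply/andP; split.
    by apply: fine_ge0; apply: integral_ge0 => x _; rewrite lee_fin.
  apply: le_trans (sec H dH) _.
  have mD : measurable ([set x | L x <= 1] `&` [set` H]).
    by apply: measurableI; [exact: measurable_gauge_le|exact: measurable_subspace].
  have [U [UU UH]] := orthonormal_basis_exists dH.
  have fg : (\int[lebesgue_on H]_(x in [set x | (L x <= 1)%R] `&` [set` H]) (g x)%:E)%E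
      \is a fin_num.
    by rewrite (section_integralE gL cg g0 dH UU UH) section_integral_fin_num.
  have mg : measurable_fun ([set x | L x <= 1] `&` [set` H]) (EFin \o g).
    by apply/measurable_EFinP; apply: measurable_funTS; exact: continuous_measurable_fun_rV.
  have eg0 x : ([set x | L x <= 1] `&` [set` H]) x -> (0 <= (EFin \o g) x)%E.
    by rewrite lee_fin.
  have e0 : (0 <= eps%:E)%E by rewrite lee_fin.
  have := ge0_integralZl (lebesgue_on H) mD mg eg0 e0.
  rewrite /g'; under eq_integral do rewrite -EFinM.
  by move=> ->; rewrite fineM.
have [C hC] := spherical_radon_bounded gL cg' g'0.
have step : \int[sphere_measure n]_(x in sphere n) (M x ^- k * h1 x) <=
    \int[sphere_measure n]_(x in sphere n) (M x ^- k * h2 x).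
  rewrite (hnu h1); last exact: radial_within.
  rewrite (hnu h2); last exact: radial_within.
  rewrite nk; apply: (@ge0_le_Rintegral_lower _ _ R nu _ _ _ C) => H.
    exact: radon_le.
  exact: hC.
have E (h : 'rV[R]_n -> R) : \int[sphere_measure n]_(x in sphere n) (M x ^- k * h x) =
    fine (\int[sphere_measure n]_(x in sphere n) ((M x)^-1 ^+ k * h x)%:E)%E.
  by congr fine; apply: eq_integral => x _; rewrite exprVn.
rewrite !E in step.
have NM x : N x <= 1 -> M x <= 1.
  by move=> /ND; rewrite {1}DE.
apply: (@le_trans _ _ (fine (\int[sphere_measure n]_(x in sphere n)
    ((M x)^-1 ^+ k * h1 x)%:E)%E)).
  apply: fine_le; [exact: body_fun_fin_num|exact: sphere_fin_num|].
  exact: integral_body_fun_le_radial.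
apply: le_trans step _.
have W0 x : 0 <= (M x)^-1 ^+ k by rewrite exprn_ge0// invr_ge0 gauge_ge0.
apply: fine_leP.
  apply: integral_ge0 => x _; rewrite lee_fin mulr_ge0//.
  exact: radial_fun_ge0.
rewrite (integral_inv_gauge_radial_fun m0 nmk gL gM cg' g'0).
have mW : measurable_fun setT (fun x => (((M x)^-1 ^+ k)%:E * (body_fun L g x)%:E)%E).
  apply: emeasurable_funM; apply/measurable_EFinP; first exact: measurable_inv_gauge.
  exact: measurable_body_fun.
have Wg0 x : setT x -> (0 <= ((M x)^-1 ^+ k)%:E * (body_fun L g x)%:E)%E.
  by move=> _; apply: mule_ge0; rewrite lee_fin//; exact: body_fun_ge0.
have e0 : (0 <= eps%:E)%E by rewrite lee_fin.
have bound := @integral_inv_gauge_bathtub R n m k m0 nmk M (body_fun L g) V I gM.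
have {}bound := bound (measurable_body_fun gL cg).
rewrite EFinM; apply: le_trans (lee_wpmul2l e0 (bound _ _ V0 IE I0)).
- rewrite -(ge0_integralZl (leb n) measurableT mW Wg0 e0).
  rewrite le_eqVlt; apply/orP; left; apply/eqP; apply: eq_integral => x _.
  by rewrite body_funZ EFinM muleCA.
- move=> x; rewrite body_fun_ge0//= /body_fun; case: ifPn => // Lx; exact: g1.
- by rewrite -VE [in RHS]DE.
Qed.

End key_inequality.

(** * The inequality *)

Section main.
Context {R : realType}.
Local Notation leb := (@lebesgue_rV R).

(** A positive value of f on the body persists at a slightly smaller multiple of the point, which is
    interior; a section through that multiple has positive integral, against the hypothesis. *)
Lemma integral_body_fun_eq0 n m (N f : 'rV[R]_n -> R) : (0 < m <= n)%N ->
  gauge N -> continuous f -> (forall x, 0 <= f x) ->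
  (forall H, \dim H = m ->
     fine (\int[lebesgue_on H]_(x in [set x | (N x <= 1)%R] `&` [set` H]) (f x)%:E)%E <= 0) ->
  (\int[leb n]_x (body_fun N f x)%:E)%E = 0%E.
Proof.
move=> mn gN cf f0 sec; apply: integral0_eq => x _; congr EFin.
apply/eqP; rewrite eq_le body_fun_ge0// andbT leNgt; apply/negP.
rewrite /body_fun; case: ifPn => [Nx fx|_]; last by rewrite ltxx.
have [_ NZ _] := gN.
have [s /andP[s0 s1] fs] : exists2 s : R, 0 <= s < 1 & 0 < f (s *: x).
  have cfs : continuous (fun s : R => f (s *: x)).
    move=> s; apply: (@continuous_comp _ _ _ (fun s : R => s *: x) f); last exact: cf.
    exact: scalel_continuous.
  have : nbhs (f (1 *: x)) [set r | 0 < r].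
    by apply: open_nbhs_nbhs; split; [exact: open_gt|rewrite /= scale1r].
  move=> /(cfs 1)/nbhs_ballP[e /= e0 be].
  (* The bound e/2 keeps s within e of 1, and the bound 1/2 keeps it non-negative. *)
  exists (1 - Num.min (e / 2) 2^-1).
    have h1 : Num.min (e / 2) 2^-1 <= 2^-1 by rewrite ge_min lexx orbT.
    have h2 : 0 < Num.min (e / 2) (2^-1 : R) by rewrite lt_min divr_gt0//= invr_gt0.
    by apply/andP; split; lra.
  apply: be; rewrite /ball/= opprB addrC subrK gtr0_norm; last first.
    by rewrite lt_min divr_gt0//= invr_gt0.
  by rewrite (@le_lt_trans _ _ (e / 2)) ?ge_min ?lexx//; lra.
have [H dH xH] := subspace_containing (s *: x) mn.
have [U [UU UH]] := orthonormal_basis_exists dH.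
have [y yE] : exists y : 'rV[R]_m, s *: x = y *m U.
  by apply: rowspanP; rewrite -(rowspan_eq UU UH dH).
have m0 : (0 < m)%N by case/andP: mn.
have := sec H dH; rewrite (section_integralE gN cf f0 dH UU UH).
apply/negP; rewrite -ltNge fine_gt0// -ge0_fin_numE; last first.
  by apply: integral_ge0 => z _; rewrite lee_fin; exact: body_fun_ge0.
rewrite section_integral_fin_num// andbT.
apply: (integral_body_fun_gt0 gN cf f0 (y := y)); rewrite -yE//.
by rewrite NZ// (le_lt_trans _ s1)// ler_piMr.
Qed.

Lemma lebesgue_star_body n (K : set 'rV[R]_n) : star_body K ->
  lebesgue_rV n K = (volume K)%:E /\ 0 < volume K.
Proof.
move=> hK; have gN := star_body_gauge hK.
have mK : measurable K by rewrite (star_body_setE hK); exact: measurable_gauge_le.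
have Koo : (leb n K < +oo)%E.
  have [_ [M [_ KM]] _ _ _] := hK.
  apply: (@lebesgue_rV_bounded _ _ (M + 1)) => // x i Kx.
  apply: le_trans (KM (M + 1) _ x Kx); last by rewrite ltrDl.
  rewrite [X in _ <= X]/Num.norm/= mx_normrE.
  exact: (le_bigmax _ (fun ij : 'I_1 * 'I_n => `|x ij.1 ij.2|) (ord0, i)).
have K0 : (0 < leb n K)%E.
  rewrite [X in leb n X](star_body_setE hK); exact: lebesgue_gauge_ball_gt0.
have fK : leb n K \is a fin_num by rewrite ge0_fin_numE.
rewrite /volume; split; first by rewrite fineK.
by rewrite fine_gt0// K0.
Qed.

(** The root (c / b)^(1/k) is a lower bound of S, hence at most its infimum, and k-th powers are
    monotone on non-negative numbers. *)
Lemma le_ereal_inf_expe (S : set \bar R) (k : nat) (b c : R) : (0 < k)%N -> 0 < b ->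
  0 <= c ->
  (forall e, S e -> exists2 r, e = r%:E & 0 <= r /\ c <= b * r ^+ k) ->
  (c%:E <= b%:E * ereal_inf S ^+ k)%E.
Proof.
move=> k0 b0 c0 Sb.
have cb0 : 0 <= c / b by rewrite divr_ge0// ltW.
pose r := (c / b) `^ k%:R^-1.
have r0 : 0 <= r by exact: powR_ge0.
have kn : k%:R != 0 :> R by rewrite pnatr_eq0 -lt0n.
have rk : r ^+ k = c / b.
  by rewrite -powR_mulrn// -powRrM mulVf// powRr1.
have : (r%:E <= ereal_inf S)%E.
  apply: le_ereal_inf_tmp => e /Sb[q -> [q0 cq]]; rewrite lee_fin.
  by rewrite -(ler_pXn2r k0) ?nnegrE// rk ler_pdivrMr// mulrC.
(* The infimum is real, or +oo as for an empty family; -oo is excluded by the lower bound. *)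
case: (ereal_inf S) => [d|_|//].
  rewrite lee_fin -EFin_expe -EFinM lee_fin => rd.
  have : c / b <= d ^+ k by rewrite -rk (ler_pXn2r k0) ?nnegrE// (le_trans r0).
  by rewrite ler_pdivrMr// mulrC.
have -> : (+oo ^+ k = +oo :> \bar R)%E.
  case: (k) k0 => // k' _; elim: k' => [|k' IH]; first by [].
  by rewrite expeS IH mulyy.
by rewrite gt0_muley ?lte_fin// leey.
Qed.

End main.

Theorem theorem1 (R : realType) (n k : nat) (hn : (2 <= n)%N)
  (hk : (0 < k < n)%N) (K L : set 'rV[R]_n) (f g : 'rV[R]_n -> R)
  (hK : star_body K) (hL : star_body L)
  (f_cont : {within K, continuous f}) (f_ge0 : forall x, K x -> 0 <= f x)
  (g_cont : {within L, continuous g}) (g_ge0 : forall x, L x -> 0 <= g x)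
  (g_sup : sup (g @` L) = 1) (g_at0 : g 0 = 1) :
  let section_ratio (H : {vspace 'rV[R]_n}) : R :=
    (\int[lebesgue_on H]_(x in K `&` [set` H]) f x) /
    (\int[lebesgue_on H]_(x in L `&` [set` H]) g x) in
  exists H0 : {vspace 'rV[R]_n},
    [/\ Gr n (n - k)%N H0,
        forall H, Gr n (n - k)%N H -> section_ratio H <= section_ratio H0 &
        (((\int[lebesgue_rV n]_(x in K) f x) /
          ((\int[lebesgue_rV n]_(x in L) g x) `^ ((n - k)%N%:R / n%:R) *
           volume K `^ (k%:R / n%:R)))%:E
         <= (n%:R / (n - k)%N%:R)%:E *
            d_ovr K (gen_intersection_body k) ^+ k *
            (section_ratio H0)%:E)%E].
Proof.
move=> section_ratio.
case/andP: hk => k0 kn.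
set m := (n - k)%N; have m0 : (0 < m)%N by rewrite subn_gt0.
have nmk : n = (m + k)%N by rewrite subnK// ltnW.
have mn : (0 < m <= n)%N by rewrite m0 leq_subr.
have n0 : (0 < n)%N by exact: ltnW.
pose N := minkowski_functional K; pose P := minkowski_functional L.
have gN : gauge N by exact: star_body_gauge.
have gP : gauge P by exact: star_body_gauge.
have KN x : K x <-> N x <= 1 by exact: star_bodyE.
have LP x : L x <-> P x <= 1 by exact: star_bodyE.
pose f' := f \o gauge_retract N; pose g' := g \o gauge_retract P.
have cf : continuous f' by exact: (continuous_comp_retract gN KN).
have cg : continuous g' by exact: (continuous_comp_retract gP LP).
have f0 x : 0 <= f' x by apply: f_ge0; apply/KN; exact: gauge_retract_le1.
have g0 x : 0 <= g' x by apply: g_ge0; apply/LP; exact: gauge_retract_le1.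
have fE x : K x -> f x = f' x by move=> /KN Kx; rewrite /f' /= gauge_retract_id.
have gE x : L x -> g x = g' x by move=> /LP Lx; rewrite /g' /= gauge_retract_id.
have g1 x : P x <= 1 -> g' x <= 1.
  move=> /LP Lx; rewrite -gE// -g_sup; apply: ub_le_sup; last by exists x.
  (* A set without upper bound has [sup] equal to 0 by default, so the value 1 forces g to be
     bounded on L. *)
  apply: contrapT => nub; move: g_sup; rewrite sup_out; last by case.
  by move=> /eqP; rewrite eq_sym oner_eq0.
have KE : [set x | N x <= 1] = K by rewrite [RHS](star_body_setE hK).
have LE : [set x | P x <= 1] = L by rewrite [RHS](star_body_setE hL).
pose A (H : {vspace 'rV[R]_n}) : R :=
  fine (\int[lebesgue_on H]_(x in [set x | (N x <= 1)%R] `&` [set` H]) (f' x)%:E)%E.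
pose B (H : {vspace 'rV[R]_n}) : R :=
  fine (\int[lebesgue_on H]_(x in [set x | (P x <= 1)%R] `&` [set` H]) (g' x)%:E)%E.
have ratioE H : section_ratio H = A H / B H.
  rewrite /section_ratio /A /B KE LE; congr (_ / _); congr fine.
    by apply: eq_integral => x /set_mem[Kx _]; rewrite fE.
  by apply: eq_integral => x /set_mem[Lx _]; rewrite gE.
have fintE : \int[lebesgue_rV n]_(x in K) f x =
    fine (\int[lebesgue_rV n]_x (body_fun N f' x)%:E)%E.
  congr fine; rewrite integral_mkcond; apply: eq_integral => x _.
  rewrite patchE /body_fun; case: ifPn => [/set_mem Kx|nKx].
    by rewrite fE//; move/KN : Kx => ->.
  by case: ifPn => // /KN /mem_set Kx; rewrite Kx in nKx.
have gintE : \int[lebesgue_rV n]_(x in L) g x =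
    fine (\int[lebesgue_rV n]_x (body_fun P g' x)%:E)%E.
  congr fine; rewrite integral_mkcond; apply: eq_integral => x _.
  rewrite patchE /body_fun; case: ifPn => [/set_mem Lx|nLx].
    by rewrite gE//; move/LP : Lx => ->.
  by case: ifPn => // /LP /mem_set Lx; rewrite Lx in nLx.
have g'0 : g' 0 = 1.
  by rewrite /g' /= gauge_retract_id ?(gauge0 gP)// g_at0.
(* g equals 1 at the origin, an interior point of L that lies on every subspace, so neither the
   denominators of the ratios nor the integral of g over L can vanish. *)
have gpos j (U : 'M[R]_(j, n)) : (0 < j)%N -> U *m U^T = 1%:M ->
    0 < fine (\int[lebesgue_rV j]_y (body_fun P g' (y *m U))%:E)%E.
  move=> j0 UU; rewrite fine_gt0// -ge0_fin_numE; last first.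
    by apply: integral_ge0 => z _; rewrite lee_fin; exact: body_fun_ge0.
  rewrite section_integral_fin_num// andbT.
  by apply: (integral_body_fun_gt0 gP cg g0 (y := 0));
    rewrite mul0mx ?(gauge0 gP) ?g'0 ltr01.
pose phi (v : 'rV[R]_(m * n)) : R :=
  spherical_section N f' v / spherical_section P g' v.
have sectionE (Q h : 'rV[R]_n -> R) (v : 'rV[R]_(m * n)) : gauge Q -> continuous h ->
    (forall x, 0 <= h x) -> stiefel v ->
    spherical_section Q h v =
    fine (\int[lebesgue_rV m]_y (body_fun Q h (y *m vec_mx v))%:E)%E.
  move=> gQ ch h0 vv.
  by rewrite /spherical_section (integral_body_fun_polar m0 gQ ch h0 vv).
have ratio_phi H (U : 'M[R]_(m, n)) : \dim H = m -> U *m U^T = 1%:M ->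
    (forall i, row i U \in H) -> section_ratio H = phi (mxvec U).
  move=> dH UU UH; have vv : stiefel (mxvec U) by rewrite /stiefel/= mxvecK.
  rewrite ratioE /phi (sectionE _ _ _ gN cf f0 vv) (sectionE _ _ _ gP cg g0 vv) mxvecK.
  by rewrite /A /B (section_integralE gN cf f0 dH UU UH) (section_integralE gP cg g0 dH UU UH).
have S0 : @stiefel R m n !=set0.
  have [H dH _] := @subspace_containing R n m 0 mn.
  have [U [UU _]] := orthonormal_basis_exists dH.
  by exists (mxvec U); rewrite /stiefel/= mxvecK.
have phi_cont : {within @stiefel R m n, continuous phi}.
  apply: continuous_in_subspaceT => v /set_mem vv.
  apply: (@continuousM R _ (spherical_section N f') (fun v => (spherical_section P g' v)^-1)).
    exact: spherical_section_continuous.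
  apply: (@continuous_comp _ _ _ (spherical_section P g') (fun r : R => r^-1)).
    exact: spherical_section_continuous.
  by apply: inv_continuous; rewrite gt_eqF// (sectionE _ _ _ gP cg g0 vv) gpos.
have [v0 /set_mem v0S vmax] := compact_EVT_max S0 (@compact_stiefel R m n) phi_cont.
pose H0 := rowspan (vec_mx v0 : 'M[R]_(m, n)).
have dH0 : \dim H0 = m by exact: dim_rowspan.
have H0max H : \dim H = m -> section_ratio H <= section_ratio H0.
  move=> dH; have [U [UU UH]] := orthonormal_basis_exists dH.
  have E0 : section_ratio H0 = phi v0.
    by rewrite -[in RHS](vec_mxK v0); exact: (ratio_phi _ _ dH0 v0S (row_rowspan _)).
  have SU : mxvec U \in @stiefel R m n by apply/mem_set; rewrite /stiefel/= mxvecK.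
  rewrite (ratio_phi _ _ dH UU UH) E0; exact: vmax SU.
exists H0; split; [exact: dH0|exact: H0max|].
have Bpos H : \dim H = m -> 0 < B H.
  move=> dH; have [U [UU UH]] := orthonormal_basis_exists dH.
  by rewrite /B (section_integralE gP cg g0 dH UU UH) gpos.
have A0 H : 0 <= A H.
  by apply: fine_ge0; apply: integral_ge0 => x _; rewrite lee_fin.
set eps := section_ratio H0.
have eps0 : 0 <= eps by rewrite /eps ratioE divr_ge0// ltW// Bpos.
have AB H : \dim H = m -> A H <= eps * B H.
  by move=> dH; rewrite -ler_pdivrMr ?Bpos// -ratioE H0max.
rewrite fintE gintE.
set I := fine (\int[lebesgue_rV n]_x (body_fun P g' x)%:E)%E.
set J := fine (\int[lebesgue_rV n]_x (body_fun N f' x)%:E)%E.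
have IE : (\int[lebesgue_rV n]_x (body_fun P g' x)%:E)%E = I%:E.
  by rewrite fineK//; exact: body_fun_fin_num.
have I0 : 0 < I.
  rewrite /I -(mulmx1_integral (fun x => (body_fun P g' x)%:E)) gpos//.
  by rewrite mul1mx trmx1.
have J0 : 0 <= J.
  by apply: fine_ge0; apply: integral_ge0 => x _; rewrite lee_fin; exact: body_fun_ge0.
have [_ VK0] := lebesgue_star_body hK.
have Ip : 0 < I `^ (m%:R / n%:R) by rewrite powR_gt0.
have Kp : 0 < volume K `^ (k%:R / n%:R) by rewrite powR_gt0.
(* When all section integrals of f vanish, the right-hand side is 0 whatever the distance, even +oo,
   so the integral of f itself has to vanish. *)
have [eps_eq0|eps_neq0] := eqVneq eps 0.
  have JE : J = 0.
    rewrite /J (integral_body_fun_eq0 mn gN cf f0)// => H dH.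
    by have := AB H dH; rewrite eps_eq0 mul0r.
  by rewrite JE eps_eq0 mul0r mule0.
have eps_gt0 : 0 < eps by rewrite lt_neqAle eq_sym eps_neq0.
have nm0 : 0 < n%:R / m%:R :> R by rewrite divr_gt0// ltr0n.
(* Grouping eps with n/m gives the positive real factor that [le_ereal_inf_expe] expects in front of
   the power. *)
rewrite muleAC -EFinM.
apply: le_ereal_inf_expe => //.
- by rewrite mulr_gt0.
- by rewrite divr_ge0// mulr_ge0// ltW.
move=> _ [D [KD hD] <-]; exists ((volume D / volume K) `^ n%:R^-1) => //.
split; first exact: powR_ge0.
have [sD _ _] := hD; have [VE VD0] := lebesgue_star_body sD.
have ND : [set x | N x <= 1] `<=` D by rewrite KE.
have key := key_inequality m0 nmk gN gP cf f0 cg g0 g1 hD ND eps0 AB VE VD0 IE I0.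
rewrite ler_pdivrMr ?mulr_gt0//; apply: le_trans key _.
have q0 : 0 < volume D / volume K by rewrite divr_gt0.
rewrite -powR_mulrn ?powR_ge0// -powRrM (mulrC n%:R^-1).
(* The k-th power of the volume ratio distance of D is (|D|/|K|)^(k/n); the factor |K|^(k/n) from
   the denominator on the left completes it to |D|^(k/n). *)
have -> : volume D `^ (k%:R / n%:R) =
    (volume D / volume K) `^ (k%:R / n%:R) * volume K `^ (k%:R / n%:R).
  by rewrite -powRM ?(ltW q0) ?(ltW VK0)// divfK// gt_eqF.
by rewrite le_eqVlt; apply/orP; left; apply/eqP; ring.
Qed.
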